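(* Let $H$ be an $n\times n$ Hadamard matrix with $n\equiv4\pmod 8$ and $G_H$ its Hadamard graph. Suppose $\{D,C_1,\dots,C_{14}\}$ is a switching partition of the vertex set of $G_H$ (with $D$ the special set and $\{C_1,\dots,C_{14}\}$ the switching set) satisfying: (1) the partition has exactly these 15 sets; (2) $|D|=16$, $|C_1|=|C_2|=n/2-2$, $|C_3|=|C_4|=\dots=|C_{14}|=n/4-1$; (3) $D$ consists of eight vertices with loops and eight without; for each vertex of $D$ with (resp. without) a loop there is another vertex of $D$ with (resp. without) a loop that has no common neighbours with it; (4) all vertices of $C_1$ have loops; for every vertex of $C_1$ there is another vertex of $C_1$ with no common neighbours with it; half of the vertices of $C_1$ are adjacent to the same four vertices of $D$; (5) no vertex of $C_2$ has a loop; for every vertex of $C_2$ there is another vertex of $C_2$ with no common neighbours with it; half of the vertices of $C_2$ are adjacent to the same four vertices of $D$; (6) all vertices of $C_i$, $i\in\{3,4,7,8,11,12\}$, have loops, while no vertex of $C_j$, $j\in\{5,6,9,10,13,14\}$, has a loop; (7) four vertices of $D$ are adjacent to all vertices of $C_3,C_7,C_{11}$; four different vertices of $D$ are adjacent to all vertices of $C_4,C_8,C_{12}$; four other vertices of $D$ are adjacent to all vertices of $C_5,C_9,C_{13}$; and the remaining four vertices of $D$ are adjacent to all vertices of $C_6,C_{10},C_{14}$. Then GM-switching on $G_H$ with respect to this partition is equivalent to switching a Hall set on $H$, i.e. the resulting graph is (isomorphic to) the Hadamard graph of a matrix obtained from $H$ by switching a Hall set.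
   Context: A Hadamard matrix is a square $n\times n$ matrix $H$ with entries in $\{1,-1\}$ with $HH^T=nI$; equivalence means permuting and negating rows and columns. Let $n\equiv4\pmod 8$, $m=n/4-1$. $H$ has a Hall set precisely when it is equivalent to a matrix of block form with block rows $(H_4,F_1,F_2,F_3,F_4)$ and $(G_i,A_{i1},A_{i2},A_{i3},A_{i4})$ for $i=1,\dots,4$, where $H_4$ is the $4\times4$ matrix with $1$ on the diagonal and $-1$ elsewhere; $F_1,\dots,F_4$ are $4\times m$ with constant rows, the rows (top to bottom) being all $1,1,1,1$ for $F_1$; $1,-1,-1,1$ for $F_2$; $1,-1,1,-1$ for $F_3$; $-1,-1,1,1$ for $F_4$; $G_1=F_1^T$, $G_j=-F_j^T$ for $j=2,3,4$; and each $A_{ij}$ is an $m\times m$ $\{1,-1\}$-matrix with all row and column sums $2$ if $i=j$ and $0$ otherwise. Switching a Hall set means: bring $H$ to this form and negate $F_i$ and the corresponding $G_i$ for one $i\in\{1,2,3,4\}$. Hadamard graph: $G_H$ has vertices $v_1,\dots,v_n,v'_1,\dots,v'_n,w_1,\dots,w_n,w'_1,\dots,w'_n$; if $h_{ij}=1$ it has edges $v_iw_j$, $v'_iw'_j$, and if $h_{ij}=-1$ edges $v_iw'_j$, $v'_iw_j$; there is a loop at each $v_i$ and $v'_i$ and at no other vertex (a vertex with a loop counts as its own neighbour). GM-switching: a partition $\{C_1,\dots,C_t,D\}$ of the vertex set is a switching partition if (i) for all $i,j$, every vertex of $C_i$ has the same number of neighbours in $C_j$, and (ii) every vertex of $D$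 has $0$, $\tfrac12|C_i|$ or $|C_i|$ neighbours in each $C_i$. GM-switching means: for every $i$ and every $v\in D$ with exactly $\tfrac12|C_i|$ neighbours in $C_i$, replace the adjacencies between $v$ and $C_i$ by their complement. *)

(* Defs.v *)
From mathcomp Require Import all_boot all_order all_fingroup all_algebra.

Set Implicit Arguments.
Unset Strict Implicit.
Unset Printing Implicit Defensive.

Import GRing.Theory.
Local Open Scope ring_scope.

(** * Hadamard matrices and Hall sets *)

Definition pm1_mx (m n : nat) (A : 'M[int]_(m, n)) : Prop :=
  forall i j, A i j = 1 \/ A i j = -1.

Definition hadamard (n : nat) (H : 'M[int]_n) : Prop :=
  pm1_mx H /\ H *m H^T = (n%:R)%:M.

Definition had_equiv (n : nat) (H K : 'M[int]_n) : Prop :=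
  exists (s t : 'S_n) (a b : 'I_n -> bool),
    forall i j, K i j = (-1) ^+ a i * (-1) ^+ b j * H (s i) (t j).

Definition hallH4 : 'M[int]_4 := \matrix_(i, j) (if i == j then 1 else -1).

(* Entry number r of list number j is the constant value of row r of F_(j+1). *)
Definition hallF_rows : seq (seq int) :=
  [:: [:: 1; 1; 1; 1]; [:: 1; -1; -1; 1]; [:: 1; -1; 1; -1];
      [:: -1; -1; 1; 1]].

Definition hallF (m : nat) (j : 'I_4) : 'M[int]_(4, m) :=
  \matrix_(r, k) (nth [::] hallF_rows j)`_r.

Definition hallG (m : nat) (i : 'I_4) : 'M[int]_(m, 4) :=
  if i == ord0 then (hallF m i)^T else - (hallF m i)^T.

Definition hall_core (m : nat) (A : 'I_4 -> 'I_4 -> 'M[int]_m) : Prop :=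
  forall i j,
    [/\ pm1_mx (A i j),
        forall k, \sum_l A i j k l = (if i == j then 2 else 0)
      & forall l, \sum_k A i j k l = (if i == j then 2 else 0)].

Definition hall_mx (m : nat) (F : 'I_4 -> 'M[int]_(4, m))
    (G : 'I_4 -> 'M[int]_(m, 4)) (A : 'I_4 -> 'I_4 -> 'M[int]_m) :
    'M[int]_(4 + \sum_(i < 4) m) :=
  block_mx hallH4        (\mxrow_(j < 4) F j)
           (\mxcol_(i < 4) G i) (\mxblock_(i < 4, j < 4) A i j).

Definition negate_at (V : zmodType) (i0 : 'I_4) (F : 'I_4 -> V) (j : 'I_4) : V :=
  if j == i0 then - F j else F j.

(* [H'] is obtained from [H] by switching a Hall set. The equation [e] forces
   m = n / 4 - 1. *)
Definition hall_switch (n : nat) (H H' : 'M[int]_n) : Prop :=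
  exists (m : nat) (e : (4 + \sum_(i < 4) m)%N = n)
         (A : 'I_4 -> 'I_4 -> 'M[int]_m) (i0 : 'I_4),
    [/\ hall_core A,
        had_equiv H (castmx (e, e) (hall_mx (hallF m) (hallG m) A))
      & H' = castmx (e, e)
               (hall_mx (negate_at i0 (hallF m)) (negate_at i0 (hallG m)) A)].

(** * Graphs with loops and GM-switching

   A graph is a symmetric relation on a finite type; [e x x] means that [x]
   has a loop, and then [x] is one of its own neighbours. *)

Definition graph_iso (V V' : finType) (e : rel V) (e' : rel V') : Prop :=
  exists f : V -> V', bijective f /\ forall x y, e' (f x) (f y) = e x y.

Definition nbrs_in (V : finType) (e : rel V) (x : V) (A : {set V}) : nat :=
  #|[set y in A | e x y]|.

Definition no_common_nbr (V : finType) (e : rel V) (x y : V) : Prop :=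
  forall z, ~~ (e x z && e y z).

Definition switching_partition (V : finType) (e : rel V) (t : nat)
    (C : 'I_t -> {set V}) (D : {set V}) : Prop :=
  [/\ [/\ partition (D |: [set C i | i : 'I_t]) [set: V],
          injective C & forall i, C i != D],
      forall i j x y, x \in C i -> y \in C i ->
        nbrs_in e x (C j) = nbrs_in e y (C j)
    & forall i x, x \in D ->
        [\/ nbrs_in e x (C i) = 0%N, (2 * nbrs_in e x (C i))%N = #|C i|
          | nbrs_in e x (C i) = #|C i|]].

Definition gm_flip (V : finType) (e : rel V) (t : nat)
    (C : 'I_t -> {set V}) (D : {set V}) : rel V :=
  fun x y => (x \in D) &&
    [exists i, (y \in C i) && ((2 * nbrs_in e x (C i))%N == #|C i|)].

Definition gm_switch (V : finType) (e : rel V) (t : nat)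
    (C : 'I_t -> {set V}) (D : {set V}) : rel V :=
  fun x y => e x y (+) (gm_flip e C D x y || gm_flip e C D y x).

(** * Hadamard graphs

   v_i = inl (i, false), v'_i = inl (i, true),
   w_j = inr (j, false), w'_j = inr (j, true). *)

Definition had_vertex (n : nat) : finType :=
  (('I_n * bool) + ('I_n * bool))%type.

Definition had_graph (n : nat) (H : 'M[int]_n) : rel (had_vertex n) :=
  fun x y =>
    match x, y with
    | inl (i, a), inl (j, b) => (i == j) && (a == b)
    | inl (i, a), inr (j, b) => H i j == (if a == b then 1 else -1)
    | inr (j, b), inl (i, a) => H i j == (if a == b then 1 else -1)
    | inr _, inr _ => false
    end.

(** * Conditions on a switching partition with cells D, C_1, ..., C_14 *)

(* [cell C k] is C_k, for 1 <= k <= 14. *)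
Definition cell (V : finType) (C : 'I_14 -> {set V}) (k : nat) : {set V} :=
  C (inord k.-1).

Definition paired (V : finType) (e : rel V) (A : {set V}) : Prop :=
  forall x, x \in A ->
    exists y, [/\ y \in A, y != x, e y y = e x x & no_common_nbr e x y].

Definition half_joined (V : finType) (e : rel V) (A D : {set V}) : Prop :=
  exists S T : {set V},
    [/\ S \subset A, (2 * #|S|)%N = #|A|, T \subset D, #|T| = 4%N
      & forall x y, x \in S -> y \in T -> e x y].

(* D splits into four quadruples, the a-th of which (a = 0, 1, 2, 3) is
   completely joined to C_(k+a). This is required for k = 3, 7 and 11, and the
   splitting of D may depend on k: for the cells arising from a Hall set these
   splittings do differ, and asking for a common one would contradict the
   orthogonality of the columns of a Hadamard matrix. *)
Definition quadruples_joined (V : finType) (e : rel V)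
    (C : 'I_14 -> {set V}) (D : {set V}) (k : nat) : Prop :=
  exists Q : 'I_4 -> {set V},
    [/\ forall a, #|Q a| = 4%N,
        forall a b, a != b -> [disjoint Q a & Q b],
        \bigcup_a Q a = D
      & forall (a : 'I_4) x y, x \in cell C (k + a) -> y \in Q a -> e y x].

(* Main.v *)
Require Import Defs.
From mathcomp Require Import all_boot all_order all_fingroup all_algebra.
From mathcomp Require Import zify ring.

(** Only the four rows and four columns met by [D] matter. Call x and ng x the
   two vertices of the same row or column. The sign pattern of a row on the
   four columns of [D] is constant on each cell of rows; after normalizing the
   pattern of [C_1] to 1, orthogonality of two columns of [H] reads
   I + m J = 0, where I is their inner product on the rows of [D] and J that of
   the patterns, all vectors having length 4. As m is even this forces
   I = J = 0, so the four patterns form a Hadamard matrix of order 4, and so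
   does the core of [H] on [D].
   A row of [C_1] and its negative have equally many neighbours in each cell,
   so the row of signs is balanced on all column classes but that of [C_2];
   orthogonality with the rows of [D] makes the row sums of the core constant,
   hence equal to 2 or -2, and the core becomes the matrix [hallH4].
   The other patterns are balanced and, up to sign, run through all balanced
   vectors of length 4, so labels and signs can be chosen to give the blocks
   F_j and G_i; the line sums of the blocks A_ij are then the unique solution of
   the linear equations expressing orthogonality to the lines of [D].
   A vertex of [D] is joined to exactly half of [C_1] or [C_2], whichever is on
   the other side, and to none or all of every other cell, so that GM-switching
   negates exactly F_1 and G_1. *)

Set Implicit Arguments.
Unset Strict Implicit.
Unset Printing Implicit Defensive.

Import Order.TTheory GRing.Theory Num.Theory.
Local Open Scope ring_scope.

(** * Sign vectors of length 4 *)

Definition pm1 (x : int) : Prop := x = 1 \/ x = -1.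

Lemma pm1M x y : pm1 x -> pm1 y -> pm1 (x * y).
Proof. by rewrite /pm1; case=> ->; case=> ->; [left | right | right | left]. Qed.

Lemma pm1_sign (b : bool) : pm1 ((-1) ^+ b).
Proof. by case: b; [right | left]. Qed.

Lemma pm1_sqr x : pm1 x -> x * x = 1.
Proof. by case=> ->. Qed.

Definition o40 : 'I_4 := @Ordinal 4 0 isT.
Definition o41 : 'I_4 := @Ordinal 4 1 isT.
Definition o42 : 'I_4 := @Ordinal 4 2 isT.
Definition o43 : 'I_4 := @Ordinal 4 3 isT.

Lemma ord4_ind (Q : 'I_4 -> Prop) :
  Q o40 -> Q o41 -> Q o42 -> Q o43 -> forall i, Q i.
Proof.
move=> q0 q1 q2 q3 [[|[|[|[|//]]]] lt_i4].
- by rewrite (_ : Ordinal lt_i4 = o40) //; apply: val_inj.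
- by rewrite (_ : Ordinal lt_i4 = o41) //; apply: val_inj.
- by rewrite (_ : Ordinal lt_i4 = o42) //; apply: val_inj.
- by rewrite (_ : Ordinal lt_i4 = o43) //; apply: val_inj.
Qed.

Lemma sum4E (f : 'I_4 -> int) :
  \sum_i f i = f o40 + f o41 + f o42 + f o43.
Proof.
rewrite !big_ord_recr big_ord0 /= add0r.
by congr (f _ + f _ + f _ + f _); apply: val_inj.
Qed.

(** Four signs add up to 0, 2, -2, 4 or -4, and in the two extreme cases all products [u i * v i]
    are equal. *)
Lemma sum4_eq_pm1 (u v : 'I_4 -> int) :
    (forall i, pm1 (u i)) -> (forall i, pm1 (v i)) ->
  (\sum_i u i * v i) ^+ 2 <= 4 \/
  exists b : bool, forall i, u i = (-1) ^+ b * v i.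
Proof.
move=> up vp; rewrite sum4E.
have z i : pm1 (u i * v i) by apply: pm1M.
have uE i : u i = (u i * v i) * v i by rewrite -mulrA pm1_sqr ?mulr1.
case: (z o40) => z0; case: (z o41) => z1; case: (z o42) => z2;
  case: (z o43) => z3; rewrite z0 z1 z2 z3 /=; try (by left).
- by right; exists false; apply: ord4_ind; rewrite uE ?z0 ?z1 ?z2 ?z3 expr0.
- by right; exists true; apply: ord4_ind; rewrite uE ?z0 ?z1 ?z2 ?z3 expr1.
Qed.

(** The columns of [U] are orthogonal of squared length 4, so [U] multiplies squared lengths by 4,
    and [v] has squared length 4. *)
Lemma sum4_parseval (U : 'I_4 -> 'I_4 -> int) (v : 'I_4 -> int) :
    (forall k c, pm1 (U k c)) -> (forall c, pm1 (v c)) ->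
    (forall c d, c != d -> \sum_k U k c * U k d = 0) ->
  \sum_k (\sum_c v c * U k c) ^+ 2 = 16.
Proof.
move=> Up vp orth.
transitivity (\sum_k \sum_c \sum_d v c * v d * (U k c * U k d)).
  apply: eq_bigr => k _; rewrite expr2 mulr_suml; apply: eq_bigr => c _.
  by rewrite mulr_sumr; apply: eq_bigr => d _; ring.
rewrite exchange_big /=.
transitivity (\sum_(c < 4) (4 : int)); last by rewrite sum4E.
apply: eq_bigr => c _; rewrite exchange_big /= (bigD1 c) //= [X in _ + X]big1.
  by rewrite addr0 -mulr_sumr pm1_sqr // mul1r sum4E !pm1_sqr.
by move=> d dc; rewrite -mulr_sumr orth ?mulr0 // eq_sym.
Qed.

(** The constant row contributes 0 to the Parseval sum 16. If [v] were proportional to none of the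
    other three rows, these would contribute at most 12. *)
Lemma pattern_exists (U : 'I_4 -> 'I_4 -> int) (v : 'I_4 -> int) (e : bool) :
    (forall k c, pm1 (U k c)) -> (forall c, pm1 (v c)) ->
    (forall c, U o40 c = (-1) ^+ e) ->
    (forall c d, c != d -> \sum_k U k c * U k d = 0) -> \sum_c v c = 0 ->
  exists k (b : bool), forall c, v c = (-1) ^+ b * U k c.
Proof.
move=> Up vp U0 orth bal; have := sum4_parseval Up vp orth; rewrite sum4E.
have -> : \sum_c v c * U o40 c = 0.
  by under eq_bigr do rewrite U0; rewrite -mulr_suml bal mul0r.
case: (sum4_eq_pm1 vp (Up o41)) => [b1|[b]]; last by exists o41, b.
case: (sum4_eq_pm1 vp (Up o42)) => [b2|[b]]; last by exists o42, b.
case: (sum4_eq_pm1 vp (Up o43)) => [b3|[b]]; last by exists o43, b.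
rewrite expr0n /= add0r => E.
have := lerD (lerD b1 b2) b3; rewrite E //.
Qed.

(** * Signed rows and columns *)

(* [(i, b)] is a row (or column) [i], negated if [b] holds; it stands for the
   vertex v_i or v'_i (resp. w_i or w'_i). *)
Definition svert (n : nat) : finType := ('I_n * bool)%type.
Definition ng (n : nat) (x : svert n) : svert n := (x.1, ~~ x.2).
Definition sent (n : nat) (H : 'M[int]_n) (x y : svert n) : int :=
  (-1) ^+ x.2 * (-1) ^+ y.2 * H x.1 y.1.

Lemma ngK n : involutive (@ng n).
Proof. by case=> i b; rewrite /ng /= negbK. Qed.

Lemma sent_tr n (H : 'M[int]_n) x y : sent H^T x y = sent H y x.
Proof. by rewrite /sent mxE [X in X * _]mulrC. Qed.

Lemma sent_ngl n (H : 'M[int]_n) x y : sent H (ng x) y = - sent H x y.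
Proof. by rewrite /sent /ng /=; case: x.2 => /=; ring. Qed.

Lemma sent_ngr n (H : 'M[int]_n) x y : sent H x (ng y) = - sent H x y.
Proof. by rewrite /sent /ng /=; case: y.2 => /=; ring. Qed.

Lemma sent_pm1 n (H : 'M[int]_n) x y : hadamard H -> pm1 (sent H x y).
Proof. by case=> Hp _; do ![apply: pm1M]; try apply: pm1_sign; apply: Hp. Qed.

Lemma had_graph_row_col n (H : 'M[int]_n) x y :
  had_graph H (inl x) (inr y) = (sent H x y == 1).
Proof.
case: x y => i [] [j []]; rewrite /= /sent /= ?expr0 ?expr1; apply/eqP/eqP; lia.
Qed.

Lemma had_graph_col_row n (H : 'M[int]_n) x y :
  had_graph H (inr y) (inl x) = (sent H x y == 1).
Proof. by rewrite -had_graph_row_col; case: x y => i a [j b]. Qed.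

(** A right inverse of a square matrix is also a left inverse. To have one, the argument passes to
    the rationals, where [H^T] can be divided by [n]. *)
Lemma hadamard_tr n (H : 'M[int]_n) : (0 < n)%N -> hadamard H -> hadamard H^T.
Proof.
move=> n_gt0 [Hp HH]; split; first by move=> i j; rewrite mxE.
rewrite trmxK.
suff E : map_mx (intr : int -> rat) (H^T *m H) = map_mx intr (n%:R)%:M.
  by apply/matrixP => i j; move/matrixP: E => /(_ i j);
     rewrite mxE [RHS]mxE => /intr_inj.
have n_unit : (n%:R : rat) \is a GRing.unit by rewrite unitfE pnatr_eq0 -lt0n.
move/(congr1 (map_mx (intr : int -> rat))): HH.
rewrite !map_mxM /= !map_scalar_mx /= -!map_trmx rmorph_nat.
set K := map_mx _ H => KK.
have : (K *m (n%:R^-1 *: K^T)) = 1%:M.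
  by rewrite -scalemxAr KK scale_scalar_mx mulVr.
move/mulmx1C; rewrite -scalemxAl => /(congr1 ( *:%R n%:R)).
by rewrite scalerA mulrV // scale1r scale_scalar_mx mulr1.
Qed.

Lemma hadamard_row_orth n (H : 'M[int]_n) i j :
  hadamard H -> i != j -> \sum_k H i k * H j k = 0.
Proof.
case=> _ /matrixP/(_ i j); rewrite !mxE => + /negPf ij; rewrite ij mulr0n => E.
by rewrite -[RHS]E; apply: eq_bigr => k _; rewrite mxE.
Qed.

(** The sign of a column enters squared, so each half of the sum is, up to sign, an inner product of
    two rows of [H]. *)
Lemma sent_row_orth n (H : 'M[int]_n) (x x' : svert n) :
  hadamard H -> x.1 != x'.1 -> \sum_y sent H x y * sent H x' y = 0.
Proof.
move=> hH xx'; rewrite -(pair_bigA _ (fun j b => sent H x (j, b) * sent H x' (j, b))).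
rewrite exchange_big big1 // => b _ /=.
transitivity ((-1) ^+ x.2 * (-1) ^+ x'.2 * \sum_j H x.1 j * H x'.1 j).
  rewrite mulr_sumr; apply: eq_bigr => j _; rewrite /sent /=.
  by case: b; rewrite ?expr0 ?expr1; ring.
by rewrite hadamard_row_orth ?mulr0.
Qed.

Lemma sent_col_orth n (H : 'M[int]_n) (y y' : svert n) :
  hadamard H -> y.1 != y'.1 -> \sum_x sent H x y * sent H x y' = 0.
Proof.
move=> hH yy'; have n0 : (0 < n)%N by apply: leq_ltn_trans (ltn_ord y.1).
rewrite -[RHS](sent_row_orth (hadamard_tr n0 hH) yy').
by apply: eq_bigr => x _; rewrite !sent_tr.
Qed.

Lemma ng_closed_sum0 n (A : {set svert n}) (f : svert n -> int) :
    (forall x, (ng x \in A) = (x \in A)) -> (forall x, f (ng x) = - f x) ->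
  \sum_(x in A) f x = 0.
Proof.
move=> Ang fng; set s := \sum_(x in A) f x.
have : s = - s.
  rewrite {1}/s (reindex_inj (inv_inj (@ngK n))) /= -sumrN.
  by apply: eq_big => // x _; rewrite fng.
by lia.
Qed.

Lemma pm1_sum_card (I : finType) (A : {set I}) (f : I -> int) :
    (forall i, i \in A -> pm1 (f i)) ->
  \sum_(i in A) f i = (2 * #|[set i in A | f i == 1]|)%:Z - #|A|%:Z.
Proof.
move=> fp; rewrite (eq_bigr (fun i => 2 * (f i == 1)%:R - 1)); last first.
  by move=> i /fp[] ->.
rewrite big_split /= -mulr_sumr sumr_const mulNrn natz PoszM; congr (2 * _ - _).
rewrite -natz -sumr_const; under [RHS]eq_bigl do rewrite inE.
  by rewrite big_mkcondr /=; apply: eq_bigr => i _; case: (f i == 1).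
by rewrite natz.
Qed.

(** Exactly one of [y] and [ng y] is adjacent to [x]. *)
Lemma card_adj_half n (H : 'M[int]_n) (A : {set svert n}) x :
    hadamard H -> (forall y, (ng y \in A) = (y \in A)) ->
  (2 * #|[set y in A | sent H x y == 1%R]|)%N = #|A|.
Proof.
move=> hH Ang; have := pm1_sum_card (A := A) (f := sent H x).
rewrite (ng_closed_sum0 Ang); last by move=> y; rewrite sent_ngr.
by move=> /(_ (fun y _ => sent_pm1 x y hH)); lia.
Qed.

(** * Patterns on the special cell *)

Lemma sum_class (I K : finType) (c : I -> option K) (F : I -> int) :
  \sum_x F x =
  \sum_(x | c x == None) F x + \sum_k \sum_(x | c x == Some k) F x.
Proof.
rewrite (partition_big c predT) //= (bigD1 None) //=; congr (_ + _).
rewrite (reindex_omap Some id) /=; last by case.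
by apply: eq_big => [k|k _]; rewrite ?eqxx.
Qed.

Lemma pm1_sum_bounds (I : finType) (A : {set I}) (f : I -> int) :
    (forall i, i \in A -> pm1 (f i)) ->
  [/\ `|\sum_(i in A) f i| <= #|A|%:Z,
      \sum_(i in A) f i = #|A|%:Z -> forall i, i \in A -> f i = 1
    & \sum_(i in A) f i = - #|A|%:Z -> forall i, i \in A -> f i = -1].
Proof.
move=> fp; rewrite pm1_sum_card //; set B := [set i in A | _].
have sBA : B \subset A by apply/subsetP => i; rewrite inE => /andP[].
have leBA := subset_leq_card sBA; split; first by lia.
  move=> E i iA; have /eqP EB : B == A by rewrite eqEcard sBA; lia.
  by move: iA; rewrite -EB inE => /andP[_ /eqP].
move=> E i iA; have /cards0_eq EB : #|B| = 0%N by lia.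
have : i \notin B by rewrite EB inE.
by rewrite inE iA; case: (fp i iA) => -> //=.
Qed.

(* [c x = None] when x lies in D, and [c x = Some (k, b)] when x lies in the half
   [b] of the k-th of the four remaining classes of rows (or columns); the class
   [o40] is C_1 (or C_2). *)
Definition classified (n m : nat) (c : svert n -> option ('I_4 * bool)) :=
  [/\ forall x, (c (ng x) == None) = (c x == None),
      #|[set x | c x == None]| = 8
    & forall k b, #|[set x | c x == Some (k, b)]| = m].

Section Patterns.

Variables (n m : nat) (H : 'M[int]_n) (c d : svert n -> option ('I_4 * bool)).
Variable U : 'I_4 -> svert n -> int.
Hypotheses (H_had : hadamard H) (m_gt0 : (0 < m)%N) (m_even : ~~ odd m).
Hypotheses (c_cl : classified m c) (d_cl : classified m d).
Hypothesis U_pm1 : forall k y, pm1 (U k y).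
Hypothesis patU : forall k b x y,
  c x = Some (k, b) -> d y = None -> sent H x y = (-1) ^+ b * U k y.

Let S y z := \sum_(x | c x == None) sent H x y * sent H x z.
Let J y z := \sum_k U k y * U k z.

(** The sign [(-1) ^+ b] occurs twice in each product, so both halves of class [k] contribute alike:
    [2 * m] copies of [U k y * U k z]. *)
Lemma cell_col_sum y z : d y = None -> d z = None -> y.1 != z.1 ->
  S y z + 2 * m%:Z * J y z = 0.
Proof.
move=> dy dz yz; have := sent_col_orth H_had yz; rewrite (sum_class c) => E.
rewrite -[RHS]E; congr (_ + _).
rewrite mulr_sumr -(pair_bigA _ (fun k b => \sum_(x | c x == Some (k, b)) _)) /=.
apply: eq_bigr => k _; rewrite (eq_bigr (fun=> m%:Z * (U k y * U k z))).
  by rewrite sumr_const card_bool; ring.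
move=> b _; rewrite (eq_bigr (fun=> U k y * U k z)).
  case: c_cl => _ _ /(_ k b); rewrite cardsE sumr_const => ->.
  by rewrite -mulr_natl natz.
move=> x /eqP cx; rewrite !(patU cx) //.
by case: b {cx}; rewrite ?expr0 ?expr1; ring.
Qed.

(** For signs, [u * v + u * w + v * w] is 3 or -1, hence -1 modulo 4, and there are four such
    terms. *)
Lemma sum4_parity3 (u v w : 'I_4 -> int) :
    (forall k, pm1 (u k)) -> (forall k, pm1 (v k)) -> (forall k, pm1 (w k)) ->
  exists j : int,
    \sum_k u k * v k + \sum_k u k * w k + \sum_k v k * w k = 4 * j.
Proof.
move=> up vp wp; rewrite -!big_split /=.
pose f k := u k * v k + u k * w k + v k * w k.
have fE k : exists j, f k = 4 * j - 1.
  rewrite /f; case: (up k) => ->; case: (vp k) => ->; case: (wp k) => ->;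
    by [exists 1 | exists 0].
rewrite (eq_bigr f) // sum4E.
case: (fE o40) => j0 ->; case: (fE o41) => j1 ->.
case: (fE o42) => j2 ->; case: (fE o43) => j3 ->.
by exists (j0 + j1 + j2 + j3 - 1); ring.
Qed.

Lemma sum4_pm1_even (u v : 'I_4 -> int) :
    (forall k, pm1 (u k)) -> (forall k, pm1 (v k)) ->
  exists2 j : int, \sum_k u k * v k = 2 * j & `|j| <= 2.
Proof.
move=> up vp; rewrite sum4E.
have z i : pm1 (u i * v i) by apply: pm1M.
case: (z o40) => ->; case: (z o41) => ->; case: (z o42) => ->;
  case: (z o43) => ->;
  by [exists 2 | exists 1 | exists 0 | exists (-1) | exists (-2)].
Qed.

(** Eight signed lines are labelled [None], and the lines of [y] and [z] account for at most four of
    them. *)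
Lemma third_line y z : d y = None -> d z = None ->
  exists w, [/\ d w = None, w.1 != y.1 & w.1 != z.1].
Proof.
move=> dy dz; pose A := [set y; ng y; z; ng z].
have : ~~ ([set x | d x == None] \subset A).
  apply/negP => /subset_leq_card; case: d_cl => _ -> _.
  suff : (#|A| <= 4)%N by lia.
  apply: leq_trans (leq_card_setU _ _) _; rewrite cards1 addn1 ltnS.
  apply: leq_trans (leq_card_setU _ _) _; rewrite cards1 addn1 ltnS.
  by rewrite cards2 ltnS leq_b1.
case/subsetPn => w; rewrite !inE => /eqP dw.
have nE u : w != u -> w != ng u -> w.1 != u.1.
  case: w {dw} => i b; case: u => j e /= h1 h2; apply/eqP => ij; subst j.
  by move: h1 h2; rewrite /ng /= !xpair_eqE !eqxx /=; case: b; case: e.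
by rewrite !negb_or -!andbA => /and4P[? ? ? ?]; exists w; split=> //; apply: nE.
Qed.

(* If two columns violated the conclusion, m would be 2 and they would agree
   up to sign on the cell D; comparing both with a third column contradicts the
   parity of the pairwise inner products of three sign vectors of length 4. *)
Lemma pattern_col_orth y z : d y = None -> d z = None -> y.1 != z.1 ->
  J y z = 0 /\ S y z = 0.
Proof.
move=> dy dz yz; have E := cell_col_sum dy dz yz.
suff J0 : J y z = 0 by split=> //; move: E; rewrite J0 mulr0 addr0.
have Ev y' z' := sum4_pm1_even (U_pm1 ^~ y') (U_pm1 ^~ z').
have [j Jj j2] := Ev y z; rewrite -/(J y z) in Jj.
(* [S y z] is a sum of eight signs; an extreme value forces the two columns to agree up to sign on
   the special cell. *)
have [cE8 cE] : `|S y z| <= 8 /\ (`|S y z| = 8 -> exists b : bool,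
    forall x, c x = None -> sent H x y = (-1) ^+ b * sent H x z).
  pose A := [set x | c x == None].
  have SE : S y z = \sum_(x in A) sent H x y * sent H x z.
    by apply: eq_bigl => x; rewrite inE.
  have fp x : x \in A -> pm1 (sent H x y * sent H x z).
    by move=> _; apply: pm1M; apply: sent_pm1.
  have [b1 b2 b3] := pm1_sum_bounds fp.
  case: c_cl b1 b2 b3 => _; rewrite -/A => -> _; rewrite -SE => b1 b2 b3.
  split=> // S8; have {S8}[S8|S8] : S y z = 8 \/ S y z = - 8 by lia.
    exists false => x cx; have := b2 S8 x; rewrite inE cx => /(_ isT).
    by case: (sent_pm1 x z H_had) => ->; rewrite expr0; lia.
  exists true => x cx; have := b3 S8 x; rewrite inE cx => /(_ isT).
  by case: (sent_pm1 x z H_had) => ->; rewrite expr1; lia.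
case: (eqVneq j 0) => [j0|jn0]; first by rewrite Jj j0 mulr0.
(* [S y z] equals [- 4 * m * j] with [j] nonzero and is at most 8 in absolute value, so the positive
   even number [m] is 2. *)
have m2 : m%:Z = 2.
  have [/= a ma] : exists a : nat, m = a.*2 by exists m./2; lia.
  move: E; rewrite Jj => E; have : (`|j| >= 1) by lia.
  have : (m%:Z >= 2) by lia.
  by nia.
have S8 : `|S y z| = 8 by move: E; rewrite Jj m2; lia.
have [b bE] := cE S8; have [w [dw wy wz]] := third_line dy dz.
have JJ : J y w = (-1) ^+ b * J z w.
  have SS : S y w = (-1) ^+ b * S z w.
    by rewrite /S mulr_sumr; apply: eq_bigr => x /eqP cx; rewrite bE // [RHS]mulrA.
  rewrite eq_sym in wy; rewrite eq_sym in wz.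
  have := cell_col_sum dy dw wy; have := cell_col_sum dz dw wz.
  by rewrite SS m2; case: (b); rewrite ?expr0 ?expr1; lia.
(* [J y w] and [J z w] are even and equal up to sign, so their sum is divisible by 4, whereas
   [J y z] is 2 or -2. *)
have [l] := sum4_parity3 (U_pm1 ^~ y) (U_pm1 ^~ z) (U_pm1 ^~ w).
have [i Ji _] := Ev z w.
rewrite -/(J y z) -/(J y w) -/(J z w) in Ji *.
rewrite JJ Ji Jj; move: E; rewrite Jj m2; case: (b); rewrite ?expr0 ?expr1; lia.
Qed.

End Patterns.

(** * Signed representatives of the four special lines *)

Section Transversal.

Variables (n m : nat) (H : 'M[int]_n) (c d : svert n -> option ('I_4 * bool)).
Variable U : 'I_4 -> svert n -> int.
Hypotheses (H_had : hadamard H) (m_gt0 : (0 < m)%N).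
Hypotheses (c_cl : classified m c) (d_cl : classified m d).
Hypothesis U_pm1 : forall k y, pm1 (U k y).
Hypothesis patU : forall k b x y,
  c x = Some (k, b) -> d y = None -> sent H x y = (-1) ^+ b * U k y.

Lemma class_nonempty k b : exists x, c x = Some (k, b).
Proof.
case: c_cl => _ _ /(_ k b) cm.
have /card_gt0P[x] : (0 < #|[set x | c x == Some (k, b)]|)%N by rewrite cm.
by rewrite inE => /eqP cx; exists x.
Qed.

Lemma pattern_ng k y : d y = None -> U k (ng y) = - U k y.
Proof.
move=> dy; have [x cx] := class_nonempty k false.
have dny : d (ng y) = None by apply/eqP; case: d_cl => -> _ _; rewrite dy.
have := sent_ngr H x y; rewrite (patU cx dny) (patU cx dy) expr0 !mul1r.
by move=> ->.
Qed.

(** The pattern of class [o40] is odd under [ng], so it is 1 on exactly one of [y] and [ng y].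
    Choosing that one normalizes the pattern to 1 and picks one sign for each of the four lines. *)
Lemma sign_transversal : exists t : 'I_4 -> svert n,
  [/\ forall i, d (t i) = None, forall i, U o40 (t i) = 1,
      injective (fun i => (t i).1)
    & forall g : svert n -> int, (forall y, g (ng y) = g y) ->
        \sum_(y | d y == None) g y = 2 * \sum_i g (t i)].
Proof.
case: (d_cl) => dng d8 _; pose B := [set y | d y == None].
pose T := [set y in B | U o40 y == 1].
have Tng y : d y = None -> (ng y \in T) = (y \notin T).
  move=> dy; rewrite !inE dng dy pattern_ng //=.
  by case: (U_pm1 o40 y) => ->.
have [x cx] := class_nonempty o40 false.
(* The row [x] shows the pattern of class [o40] itself, and it is adjacent to half of the eight
   special vertices. *)
have T4 : #|T| = 4.
  have Bng y : (ng y \in B) = (y \in B) by rewrite !inE dng.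
  have := card_adj_half x H_had Bng; rewrite d8.
  rewrite (_ : [set y in B | _] = T); first by lia.
  apply/setP => y; rewrite !inE; case: eqP => //= dy.
  by rewrite (patU cx dy) expr0 mul1r.
have tT i : enum_val (cast_ord (esym T4) i) \in T by apply: enum_valP.
exists (fun i => enum_val (cast_ord (esym T4) i)); split.
- by move=> i; have := tT i; rewrite !inE => /andP[/eqP].
- by move=> i; have := tT i; rewrite !inE => /andP[_ /eqP].
- move=> i j /= E.
  suff : enum_val (cast_ord (esym T4) i) = enum_val (cast_ord (esym T4) j).
    by move/enum_val_inj/cast_ord_inj.
  have := tT i; have := tT j; move: E.
  case: (enum_val _) => a b; case: (enum_val _) => a' b' /= <-.
  case: (eqVneq b b') => [-> //|bb'] h1 h2.
  have dy : d (a, b) = None by move: h2; rewrite !inE => /andP[/eqP].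
  have := Tng _ dy; rewrite h2 /ng /=.
  have -> : ~~ b = b' by move: bb'; case: (b); case: (b').
  by rewrite h1.
move=> g gng.
transitivity (\sum_(y in B) g y); first by apply: eq_bigl => y; rewrite inE.
rewrite (bigID (mem T)) /=.
have -> : \sum_(y in B | y \notin T) g y = \sum_(y in B | y \in T) g y.
  rewrite (reindex_inj (inv_inj (@ngK n))) /=; apply: eq_big => [y|y _] //.
  rewrite !inE dng; case: eqP => //= dy; move: (Tng y dy).
  by rewrite !inE dng dy /= => ->; rewrite negbK.
have -> : \sum_(y in B | y \in T) g y = \sum_(y in T) g y.
  by apply: eq_bigl => y; rewrite !inE; case: (d y == None).
rewrite [RHS]mulr_natl mulr2n; suff -> : \sum_(y in T) g y =
  \sum_i g (enum_val (cast_ord (esym T4) i)) by [].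
rewrite big_enum_val (reindex (cast_ord (esym T4))) //=.
by exists (cast_ord T4) => i _; rewrite ?cast_ordK ?cast_ordKV.
Qed.

End Transversal.

(** * Normal form *)

(** The rows of [hallF m l] are constant, so one vector of length 4 describes the block;
    [row_pattern] does the same for [hallG], whence its sign change. *)
Definition col_pattern (l r : 'I_4) : int := (nth [::] hallF_rows l)`_r.
Definition row_pattern (k c : 'I_4) : int :=
  if k == o40 then col_pattern k c else - col_pattern k c.

Lemma col_pattern_pm1 l r : pm1 (col_pattern l r).
Proof.
by move: l r; apply: ord4_ind; apply: ord4_ind; rewrite /col_pattern /=;
  [left|left|left|left|left|right|right|left|left|right|left|right
  |right|right|left|left].
Qed.

Lemma col_pattern_bal l : l != o40 -> \sum_r col_pattern l r = 0.
Proof. by move: l; apply: ord4_ind => // _; rewrite sum4E. Qed.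

Lemma row_pattern_pm1 k c : pm1 (row_pattern k c).
Proof.
rewrite /row_pattern; case: ifP => _; first exact: col_pattern_pm1.
by case: (col_pattern_pm1 k c) => ->; [right | left].
Qed.

Lemma row_pattern_bal k : k != o40 -> \sum_c row_pattern k c = 0.
Proof. by move: k; apply: ord4_ind => // _; rewrite sum4E. Qed.

(** This assigns a half of a class to each block of the Hall form. A balanced pattern cannot come
    from the constant one, so class [o40] serves block [o40] and no other. *)
Lemma pattern_classes (U : 'I_4 -> 'I_4 -> int) (p : 'I_4 -> 'I_4 -> int)
    (e : bool) :
    (forall k c, pm1 (U k c)) -> (forall k c, pm1 (p k c)) ->
    (forall c, U o40 c = (-1) ^+ e) ->
    (forall c d, c != d -> \sum_k U k c * U k d = 0) ->
    (forall c, p o40 c = 1) -> (forall k, k != o40 -> \sum_c p k c = 0) ->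
  forall k, exists kb : 'I_4 * bool, (kb.1 == o40) = (k == o40) /\
    forall c, p k c = (-1) ^+ kb.2 * U kb.1 c.
Proof.
move=> Up pp U0 orth p0 pbal k; case: (eqVneq k o40) => [->|k0].
  exists (o40, e) => /=; split=> // c; rewrite p0 U0.
  by case: e {U0}.
have [l [b lb]] := pattern_exists Up (pp k) U0 orth (pbal k k0).
exists (l, b); split=> //=; apply/negbTE/negP => /eqP l0; subst l.
have := pbal k k0; rewrite (eq_bigr (fun=> (-1) ^+ b * (-1) ^+ e)); last first.
  by move=> c _; rewrite lb U0.
by rewrite sum4E; case: b {lb}; case: e {U0}; rewrite ?expr0 ?expr1; lia.
Qed.

(** Sum -2 leaves room for a single entry 1, as in a row of [hallH4]. *)
Lemma pm1_sum4_m2 (v : 'I_4 -> int) : (forall c, pm1 (v c)) ->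
  \sum_c v c = -2 -> exists c0, forall c, v c = if c0 == c then 1 else -1.
Proof.
move=> vp; rewrite sum4E.
case: (vp o40) => e0; case: (vp o41) => e1; case: (vp o42) => e2;
  case: (vp o43) => e3; rewrite e0 e1 e2 e3 //= => _.
- by exists o40; apply: ord4_ind.
- by exists o41; apply: ord4_ind.
- by exists o42; apply: ord4_ind.
- by exists o43; apply: ord4_ind.
Qed.

Section NormalForm.

Variables (n m : nat) (H : 'M[int]_n) (cR cC : svert n -> option ('I_4 * bool)).
Variables U V : 'I_4 -> svert n -> int.
Hypotheses (H_had : hadamard H) (m_gt0 : (0 < m)%N) (m_even : ~~ odd m).
Hypotheses (cR_cl : classified m cR) (cC_cl : classified m cC).
Hypothesis U_pm1 : forall k y, pm1 (U k y).
Hypothesis V_pm1 : forall k x, pm1 (V k x).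
Hypothesis patU : forall k b x y,
  cR x = Some (k, b) -> cC y = None -> sent H x y = (-1) ^+ b * U k y.
Hypothesis patV : forall l b x y,
  cC y = Some (l, b) -> cR x = None -> sent H x y = (-1) ^+ b * V l x.
Hypothesis balR : forall x b0 l b, cR x = Some (o40, b0) -> l != o40 ->
  \sum_(y | cC y == Some (l, b)) sent H x y = 0.

Lemma class_enum (c : svert n -> option ('I_4 * bool)) kb :
    classified m c ->
  exists f : 'I_m -> svert n, injective f /\ forall i, c (f i) = Some kb.
Proof.
case: kb => k b [_ _ /(_ k b) cm].
exists (fun i => enum_val (cast_ord (esym cm) i)); split.
  by move=> i j /enum_val_inj/cast_ord_inj.
move=> i; have : enum_val (cast_ord (esym cm) i) \in _ := enum_valP _.
by rewrite inE => /eqP.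
Qed.

(** Both signs of a line are labelled [None], or neither is. *)
Lemma class_neq (c : svert n -> option ('I_4 * bool)) x y kb :
  classified m c -> c x = None -> c y = Some kb -> x.1 != y.1.
Proof.
case=> cng _ _; case: x y => i a [j b] cx cy; apply/eqP => /= ij; subst j.
case: (eqVneq a b) => [ab|ab]; first by move: cx; rewrite ab cy.
have := cng (i, a); rewrite cx eqxx /ng /=.
have -> : ~~ a = b by move: ab; case: (a); case: (b).
by rewrite cy.
Qed.

(** Orthogonality of a special row [x] to the row [x0] of class [o40] splits over the column
    classes. The special columns give twice the row sum of the core, the classes other than [o40]
    cancel by [balR], and class [o40] gives a term depending on [x0] alone, because
    [V o40 x = 1]. *)
Lemma core_row_sum_const x0 r r' (dc : 'I_4 -> svert n) :
    cR x0 = Some (o40, false) ->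
    (forall c, cC (dc c) = None) -> (forall c, U o40 (dc c) = 1) ->
    (forall g : svert n -> int, (forall y, g (ng y) = g y) ->
        \sum_(y | cC y == None) g y = 2 * \sum_i g (dc i)) ->
    cR r = None -> cR r' = None -> V o40 r = 1 -> V o40 r' = 1 ->
  \sum_c sent H r (dc c) = \sum_c sent H r' (dc c).
Proof.
move=> cx0 dcC dcU dsum.
suff key x : cR x = None -> V o40 x = 1 -> 2 * \sum_c sent H x (dc c) +
  \sum_b (-1) ^+ nat_of_bool b * \sum_(y | cC y == Some (o40, b)) sent H x0 y
    = 0.
  by move=> cr cr' Vr Vr'; have := key _ cr Vr; have := key _ cr' Vr'; lia.
move=> cx Vx; have xx0 := class_neq cR_cl cx cx0.
have := sent_row_orth H_had xx0; rewrite (sum_class cC) => E.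
rewrite -[RHS]E; congr (_ + _).
  rewrite dsum => [|y]; last by rewrite !sent_ngr mulrNN.
  congr (_ * _); apply: eq_bigr => c _.
  by rewrite (patU cx0) // dcU expr0 !mulr1.
rewrite -(pair_bigA _ (fun k b => \sum_(x | cC x == Some (k, b)) _)) /=.
rewrite (bigD1 o40) //= [X in _ = _ + X]big1 ?addr0 => [|l l0]; last first.
  rewrite big1 // => b _.
  transitivity (\sum_(y | cC y == Some (l, b)) (-1) ^+ b * V l x * sent H x0 y).
    by apply: eq_bigr => y /eqP cy; rewrite (patV cy cx).
  by rewrite -mulr_sumr (balR b cx0 l0) mulr0.
apply: eq_bigr => b _; rewrite mulr_sumr; apply: eq_bigr => y /eqP cy.
by rewrite (patV cy cx) Vx mulr1.
Qed.

(** [dr] and [dc] list the special lines, [cr k] and [cc l] the lines of a block row and a block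
    column, and [kr], [kc] tell which half of which class fills each block. Class [o40] must stay at
    index [o40], since switching will negate the blocks there. *)
Lemma normal_form : exists (dr dc : 'I_4 -> svert n)
    (cr cc : 'I_4 -> 'I_m -> svert n) (kr kc : 'I_4 -> 'I_4 * bool),
  [/\ [/\ forall r, cR (dr r) = None, forall c, cC (dc c) = None,
          forall k i, cR (cr k i) = Some (kr k)
        & forall l j, cC (cc l j) = Some (kc l)],
      [/\ injective (fun r => (dr r).1), injective (fun c => (dc c).1),
          forall k, injective (cr k) & forall l, injective (cc l)],
      (forall k, ((kr k).1 == o40) = (k == o40)) /\
      (forall l, ((kc l).1 == o40) = (l == o40))
    & [/\ forall r c, sent H (dr r) (dc c) = if r == c then 1 else -1,
          forall r l j, sent H (dr r) (cc l j) = col_pattern l r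
        & forall k i c, sent H (cr k i) (dc c) = row_pattern k c]].
Proof.
have n_gt0 : (0 < n)%N.
  by have [x _] := class_nonempty m_gt0 cR_cl o40 false;
     apply: leq_ltn_trans (ltn_ord x.1).
(* Facts about rows are the column versions for [H^T], with [cR] and [cC] exchanged. *)
have patV' l b x y : cC x = Some (l, b) -> cR y = None ->
    sent H^T x y = (-1) ^+ b * V l y by rewrite sent_tr; apply: patV.
have H'_had := hadamard_tr n_gt0 H_had.
have orthC y z := pattern_col_orth H_had m_gt0 m_even cR_cl cC_cl U_pm1 patU
  (y := y) (z := z).
have orthR y z := pattern_col_orth H'_had m_gt0 m_even cC_cl cR_cl V_pm1 patV'
  (y := y) (z := z).
have [dc0 [dc0N dc0U dc0I dc0S]] := sign_transversal H_had m_gt0 cR_cl cC_cl U_pm1 patU.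
have [dr [drN drV drI drS]] := sign_transversal H'_had m_gt0 cC_cl cR_cl V_pm1 patV'.
pose HD0 r c := sent H (dr r) (dc0 c).
have HD0p r c : pm1 (HD0 r c) by apply: sent_pm1.
have HD0c c d : c != d -> \sum_r HD0 r c * HD0 r d = 0.
  move=> cd; have cd' : (dc0 c).1 != (dc0 d).1 by apply: contra_neq cd => /dc0I.
  have [_] := orthC _ _ (dc0N c) (dc0N d) cd'; rewrite drS => [/eqP|].
    by rewrite mulf_eq0 => /orP[//|/eqP].
  by move=> x; rewrite !sent_ngl mulrNN.
have HD0r r s : r != s -> \sum_c HD0 r c * HD0 s c = 0.
  move=> rs; have rs' : (dr r).1 != (dr s).1 by apply: contra_neq rs => /drI.
  have [_] := orthR _ _ (drN r) (drN s) rs'; rewrite dc0S.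
    by under eq_bigr do rewrite !sent_tr; move=> /eqP; rewrite mulf_eq0 => /orP[//|/eqP].
  by move=> x; rewrite !sent_ngl mulrNN.
have [x0 cx0] := class_nonempty m_gt0 cR_cl o40 false.
have HD0s r : \sum_c HD0 r c = \sum_c HD0 o40 c.
  exact: (core_row_sum_const cx0).
(* All rows of the core have the same sum [s], and Parseval for the all-one vector gives
   [4 * s ^+ 2 = 16]. The sign [e] turns [s] into -2. *)
have [e eE] : exists e : bool, forall r, \sum_c (-1) ^+ e * HD0 r c = -2.
  have := sum4_parseval HD0p (v := fun=> 1) (fun=> or_introl erefl) HD0c.
  rewrite (eq_bigr (fun=> (\sum_c HD0 o40 c) ^+ 2)); last first.
    by move=> r _; rewrite -(HD0s r); congr (_ ^+ 2); apply: eq_bigr => c _; rewrite mul1r.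
  rewrite sumr_const card_ord -mulr_natl; set s := \sum_c _ => s4.
  have /eqP : s ^+ 2 = 2 ^+ 2 by lia.
  rewrite eqf_sqr => /orP[]/eqP sE {s4}.
    by exists true => r; rewrite -mulr_sumr HD0s -/s sE.
  by exists false => r; rewrite -mulr_sumr HD0s -/s sE.
have [sg sgE] : exists sg : 'I_4 -> 'I_4,
    forall r c, (-1) ^+ e * HD0 r c = if sg r == c then 1 else -1.
  apply: (fin_all_exists (U := fun=> 'I_4)
    (P := fun r sr => forall c, (-1) ^+ e * HD0 r c = if sr == c then 1 else -1)).
  move=> r; apply: pm1_sum4_m2 => // c; apply: pm1M => //; exact: pm1_sign.
(* Equal values of [sg] would make two rows of the core equal, against their orthogonality. *)
have sgI : injective sg.
  move=> r s rs; apply/eqP/idPn => /HD0r.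
  rewrite (eq_bigr (fun=> 1)) ?sum4E // => c _.
  have := sgE r c; rewrite rs -sgE; case: e {eE sgE}; rewrite ?expr0 ?expr1;
    by case: (HD0p r c) => ->; case: (HD0p s c) => ->.
(* Permuting the columns by [sg], and negating them all if [e] holds, turns the core into [hallH4].
   The pattern of class [o40] then becomes the constant [(-1) ^+ e]. *)
pose dc c := if e then ng (dc0 (sg c)) else dc0 (sg c).
have dcE x c : sent H x (dc c) = (-1) ^+ e * sent H x (dc0 (sg c)).
  by rewrite /dc; case: e {eE sgE dc}; rewrite ?sent_ngr ?expr0 ?expr1; lia.
have dcN c : cC (dc c) = None.
  rewrite /dc; case: e {eE sgE dc dcE} => //.
  by apply/eqP; case: cC_cl => -> _ _; rewrite dc0N.
pose U' k c := (-1) ^+ e * U k (dc0 (sg c)).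
have U'p k c : pm1 (U' k c) by apply: pm1M => //; apply: pm1_sign.
have U'0 c : U' o40 c = (-1) ^+ e by rewrite /U' dc0U mulr1.
have U'o c d : c != d -> \sum_k U' k c * U' k d = 0.
  move=> cd; have cd' : (dc0 (sg c)).1 != (dc0 (sg d)).1.
    by apply: contra_neq cd => /dc0I/sgI.
  have [E _] := orthC _ _ (dc0N _) (dc0N _) cd'.
  rewrite -[RHS]E; apply: eq_bigr => k _; rewrite /U'.
  by case: (e); rewrite ?expr0 ?expr1; ring.
have rp0 c : row_pattern o40 c = 1 by move: c; apply: ord4_ind.
have [kr krE] := fin_all_exists (pattern_classes U'p row_pattern_pm1 U'0 U'o
  rp0 row_pattern_bal).
pose V' k r := V k (dr r).
have V'p k c : pm1 (V' k c) by exact: V_pm1.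
have V'0 c : V' o40 c = (-1) ^+ false by rewrite /V' drV.
have V'o c d : c != d -> \sum_k V' k c * V' k d = 0.
  move=> cd; have cd' : (dr c).1 != (dr d).1.
    by apply: contra_neq cd => /drI.
  by have [E _] := orthR _ _ (drN _) (drN _) cd'.
have cp0 c : col_pattern o40 c = 1 by move: c; apply: ord4_ind.
have [kc kcE] := fin_all_exists (pattern_classes V'p col_pattern_pm1 V'0 V'o
  cp0 col_pattern_bal).
have [cr crE] := fin_all_exists (fun k => class_enum (kr k) cR_cl).
have [cc ccE] := fin_all_exists (fun k => class_enum (kc k) cC_cl).
exists dr, dc, cr, cc, kr, kc; split; split=> //.
- by move=> k; apply: (crE k).2.
- by move=> l; apply: (ccE l).2.
- move=> c d; rewrite /dc => E; apply/sgI/dc0I.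
  by move: E; case: (e).
- by move=> k; apply: (crE k).1.
- by move=> k; apply: (ccE k).1.
- by move=> k; apply: (krE k).1.
- by move=> k; apply: (kcE k).1.
- by move=> r c; rewrite dcE sgE (inj_eq sgI).
- move=> r l j; rewrite (kcE l).2; apply: patV => //.
  by rewrite (ccE l).2; case: (kc l).
- move=> k i c; rewrite (krE k).2 dcE (patU (k := (kr k).1) (b := (kr k).2)) //.
    by rewrite mulrCA.
  by rewrite (crE k).2; case: (kr k).
Qed.

End NormalForm.

(** * The Hall matrix *)

(** [rho l] stands for a row sum of the block in position [k], [l], and the equations express
    orthogonality to the four special rows. Their coefficients [col_pattern] form a Hadamard matrix
    of order 4, so the solution is unique. *)
Lemma hall_row_sums k (rho : 'I_4 -> int) :
    (forall r, \sum_c (if r == c then 1 else -1) * row_pattern k c +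
               \sum_l col_pattern l r * rho l = 0) ->
  forall l, rho l = if k == l then 2 else 0.
Proof.
move=> E; move: (E o40) (E o41) (E o42) (E o43) => {E}.
by move: k; apply: ord4_ind; rewrite !sum4E /row_pattern /col_pattern /=;
  move=> ? ? ? ?; apply: ord4_ind; rewrite /=; lia.
Qed.

Lemma hall_col_sums l (rho : 'I_4 -> int) :
    (forall c, \sum_r (if r == c then 1 else -1) * col_pattern l r +
               \sum_k row_pattern k c * rho k = 0) ->
  forall k, rho k = if k == l then 2 else 0.
Proof.
move=> E; move: (E o40) (E o41) (E o42) (E o43) => {E}.
by move: l; apply: ord4_ind; rewrite !sum4E /row_pattern /col_pattern /=;
  move=> ? ? ? ?; apply: ord4_ind; rewrite /=; lia.
Qed.

(** Distinct vectors of either family are orthogonal, and none is its own negative. *)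
Lemma pattern_inj (p : 'I_4 -> 'I_4 -> int) :
    p = col_pattern \/ p = row_pattern ->
  forall k l, ((forall c, p k c = p l c) -> k = l) /\
              ~ (forall c, p k c = - p l c).
Proof.
move=> pE; apply: ord4_ind; apply: ord4_ind; split=> // E;
  move: (E o40) (E o41) (E o42) (E o43); case: pE => ->;
  by rewrite /row_pattern /col_pattern.
Qed.

(** * Listing signed lines in block order *)

Section Frame.

Variables (n m : nat).
Local Notation N := (4 + \sum_(i < 4) m)%N.

Definition frame (a : 'I_4 -> svert n) (B : 'I_4 -> 'I_m -> svert n)
    (i : 'I_N) : svert n :=
  match split i with
  | inl r => a r
  | inr u => B (tagnat.sig1 u) (tagnat.sig2 u)
  end.

Lemma sum_frame a B (F : svert n -> int) :
  \sum_i F (frame a B i) = \sum_r F (a r) + \sum_k \sum_i F (B k i).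
Proof.
rewrite big_split_ord /=; congr (_ + _).
  by apply: eq_bigr => r _; rewrite /frame (unsplitK (inl r)).
rewrite sig_big_dep /= (reindex _ (@tagnat.sig_bij_on 4 (fun=> m))) /=.
by apply: eq_bigr => u _; rewrite /frame (unsplitK (inr u)).
Qed.

Lemma svert_eq1 (x y : svert n) : x.1 = y.1 -> x = y \/ x = ng y.
Proof.
case: x y => i [] [j []] /= ->; by [left | right].
Qed.

(** Labels separate the special lines from the others. Two block members on one line are equal or
    opposite, hence so are their patterns, and patterns of distinct blocks are neither. *)
Lemma frame_inj (c : svert n -> option ('I_4 * bool)) a B kc
    (w : svert n -> 'I_4 -> int) p :
    classified m c -> (forall r, c (a r) = None) ->
    (forall k i, c (B k i) = Some (kc k)) -> injective (fun r => (a r).1) ->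
    (forall k, injective (B k)) -> p = col_pattern \/ p = row_pattern ->
    (forall x i, w (ng x) i = - w x i) -> (forall k i r, w (B k i) r = p k r) ->
  injective (fun i => (frame a B i).1).
Proof.
move=> c_cl ca cB aI BI pE wng wB i j E; apply: (can_inj splitK).
move: E; rewrite /frame; case: (split i) => [r|u]; case: (split j) => [s|v].
- by move/aI => ->.
- by move=> E; have /eqP := class_neq c_cl (ca r) (cB (tagnat.sig1 v) (tagnat.sig2 v)).
- by move=> E; have /eqP := class_neq c_cl (ca s) (cB (tagnat.sig1 u) (tagnat.sig2 u));
  rewrite E.
move=> E; congr inr; apply: tagnat.sig_inj; rewrite !tagnat.sigE12.
move: (tagnat.sig1 u) (tagnat.sig2 u) (tagnat.sig1 v) (tagnat.sig2 v) E.
move=> {u v} k u l v E; have [pI pN] := pattern_inj pE k l.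
case: (svert_eq1 E) => {}E.
  have kl : k = l by apply: pI => r; rewrite -(wB k u) -(wB l v) E.
  by subst l; rewrite (BI _ _ _ E).
by case: pN => r; rewrite -(wB k u) -(wB l v) E wng.
Qed.

(** By injectivity [f] visits every column once, and the chosen signs enter squared. *)
Lemma frame_row_orth (H : 'M[int]_n) (f : 'I_n -> svert n) x x' :
    hadamard H -> injective (fun j => (f j).1) -> x.1 != x'.1 ->
  \sum_j sent H x (f j) * sent H x' (f j) = 0.
Proof.
move=> hH fI xx'; have := hadamard_row_orth hH xx'.
rewrite (reindex_inj fI) /= => E.
rewrite -[RHS](mulr0 ((-1) ^+ x.2 * (-1) ^+ x'.2)) -[in RHS]E mulr_sumr.
apply: eq_bigr => j _; rewrite /sent.
by case: (f j).2; rewrite ?expr0 ?expr1; ring.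
Qed.

End Frame.

Definition in_zero_class (o : option ('I_4 * bool)) : bool :=
  if o is Some (k, _) then k == o40 else false.

(** * The Hall form and its switched version *)

Section Assembly.

Variable m : nat.
Local Notation N := (4 + \sum_(i < 4) m)%N.
Variables (H : 'M[int]_N) (cR cC : svert N -> option ('I_4 * bool)).
Variables (dr dc : 'I_4 -> svert N) (cr cc : 'I_4 -> 'I_m -> svert N).
Variables (kr kc : 'I_4 -> 'I_4 * bool).
Hypotheses (H_had : hadamard H).
Hypotheses (cR_cl : classified m cR) (cC_cl : classified m cC).
Hypotheses (drN : forall r, cR (dr r) = None) (dcN : forall c, cC (dc c) = None)
  (crE : forall k i, cR (cr k i) = Some (kr k))
  (ccE : forall l j, cC (cc l j) = Some (kc l)).
Hypotheses (drI : injective (fun r => (dr r).1))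
  (dcI : injective (fun c => (dc c).1))
  (crI : forall k, injective (cr k)) (ccI : forall l, injective (cc l)).
Hypotheses (kr0 : forall k, ((kr k).1 == o40) = (k == o40))
  (kc0 : forall l, ((kc l).1 == o40) = (l == o40)).
Hypotheses
  (HD : forall r c, sent H (dr r) (dc c) = if r == c then 1 else -1)
  (HF : forall r l j, sent H (dr r) (cc l j) = col_pattern l r)
  (HG : forall k i c, sent H (cr k i) (dc c) = row_pattern k c).

Let fr := frame dr cr.
Let fc := frame dc cc.

Lemma fr_inj : injective (fun i => (fr i).1).
Proof.
apply: (frame_inj (w := fun x c => sent H x (dc c)) cR_cl drN crE) => //.
  by right.
by move=> x i; rewrite sent_ngl.
Qed.

Lemma fc_inj : injective (fun i => (fc i).1).
Proof.
apply: (frame_inj (w := fun x r => sent H (dr r) x) cC_cl dcN ccE) => //.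
  by left.
by move=> x i; rewrite sent_ngr.
Qed.

Definition hallA (k l : 'I_4) : 'M[int]_m := \matrix_(i, j) sent H (cr k i) (cc l j).

Lemma hallA_core : hall_core hallA.
Proof.
move=> k l; split.
- by move=> i j; rewrite mxE; apply: sent_pm1.
- move=> i; under eq_bigr do rewrite mxE.
  apply: (hall_row_sums (rho := fun l => \sum_j sent H (cr k i) (cc l j))) => r.
  have rk := class_neq cR_cl (drN r) (crE k i).
  have := frame_row_orth H_had fc_inj rk.
  rewrite (sum_frame dc cc (fun y => sent H (dr r) y * sent H (cr k i) y)) => E.
  rewrite -[RHS]E; congr (_ + _).
    by apply: eq_bigr => c _; rewrite HD HG.
  apply: eq_bigr => l' _; rewrite mulr_sumr; apply: eq_bigr => j _.
  by rewrite HF.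
- move=> j; under eq_bigr do rewrite mxE.
  apply: (hall_col_sums (rho := fun k => \sum_i sent H (cr k i) (cc l j))) => c.
  have cl := class_neq cC_cl (dcN c) (ccE l j).
  have := frame_row_orth (hadamard_tr (n := N) isT H_had) fr_inj cl.
  rewrite (sum_frame dr cr (fun y => sent H^T (dc c) y * sent H^T (cc l j) y)) => E.
  rewrite -[RHS]E; congr (_ + _).
    by apply: eq_bigr => r _; rewrite !sent_tr HD HF.
  apply: eq_bigr => k' _; rewrite mulr_sumr; apply: eq_bigr => i _.
  by rewrite !sent_tr HG.
Qed.

Lemma hallF_entry r k (l : 'I_4) : hallF m l r k = col_pattern l r.
Proof. by rewrite mxE. Qed.

Lemma hallG_entry c i (k : 'I_4) : hallG m k i c = row_pattern k c.
Proof.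
rewrite /hallG /row_pattern (_ : (k == ord0) = (k == o40)) //.
by case: ifP => _; rewrite !mxE.
Qed.

Lemma framed_hall_mx :
  \matrix_(i, j) sent H (fr i) (fc j) = hall_mx (hallF m) (hallG m) hallA.
Proof.
apply/matrixP => i j; rewrite /hall_mx !mxE /fr /fc /frame.
case: (split i) => [r|u]; rewrite mxE; case: (split j) => [c|v]; rewrite mxE.
- by rewrite HD.
- by rewrite HF hallF_entry.
- by rewrite HG hallG_entry.
- by rewrite mxE.
Qed.

(** Marks the entries that will lie in F_1 or G_1, without reference to a frame; [ssent] is the sign
    table with these entries negated. *)
Definition switched x y := (cR x == None) && in_zero_class (cC y) ||
  (cC y == None) && in_zero_class (cR x).

Definition ssent x y := (-1) ^+ switched x y * sent H x y.

Lemma framed_switched_mx :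
  \matrix_(i, j) ssent (fr i) (fc j) =
    hall_mx (negate_at ord0 (hallF m)) (negate_at ord0 (hallG m)) hallA.
Proof.
have o0 (k : 'I_4) : (k == ord0) = (k == o40) by [].
have zR k i : in_zero_class (cR (cr k i)) = (k == o40).
  by rewrite crE /= -kr0; case: (kr k).
have zC l j : in_zero_class (cC (cc l j)) = (l == o40).
  by rewrite ccE /= -kc0; case: (kc l).
apply/matrixP => i j; rewrite /hall_mx !mxE /fr /fc /frame /ssent /switched.
case: (split i) => [r|u]; rewrite mxE; case: (split j) => [c|v]; rewrite mxE.
- by rewrite drN dcN HD /= expr0 mul1r.
- rewrite drN zC eqxx /= ccE /= orbF HF /negate_at o0.
  case: ifP => _; rewrite ?mxE ?expr0 ?expr1 ?mulN1r ?mul1r;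
    by rewrite ?hallF_entry.
- rewrite dcN zR eqxx /= crE /= HG /negate_at o0.
  case: ifP => _; rewrite ?[X in _ = X]mxE ?expr0 ?expr1 ?mulN1r ?mul1r;
    by rewrite ?hallG_entry.
- by rewrite crE ccE /= expr0 mul1r mxE.
Qed.

Lemma framed_equiv : had_equiv H (\matrix_(i, j) sent H (fr i) (fc j)).
Proof.
exists (perm fr_inj), (perm fc_inj), (fun i => (fr i).2), (fun j => (fc j).2).
by move=> i j; rewrite !permE mxE.
Qed.

Hypotheses (zR : forall x, in_zero_class (cR (ng x)) = in_zero_class (cR x))
  (zC : forall y, in_zero_class (cC (ng y)) = in_zero_class (cC y)).
Variable e : rel (had_vertex N).
Hypotheses (e_rr : forall x x', e (inl x) (inl x') = (x == x'))
  (e_cc : forall y y', e (inr y) (inr y') = false)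
  (e_rc : forall x y, e (inl x) (inr y) = (ssent x y == 1))
  (e_cr : forall x y, e (inr y) (inl x) = (ssent x y == 1)).

(** [e] is the Hadamard graph of the sign table [ssent]. This table is odd in both arguments, so its
    values on the framed lines, which form the switched Hall matrix, determine it. *)
Lemma hall_switch_exists : exists H' : 'M[int]_N,
  hall_switch H H' /\ graph_iso e (had_graph H').
Proof.
pose H' : 'M[int]_N := \matrix_(i, j) ssent (fr i) (fc j).
exists H'; split.
  exists m, erefl, hallA, ord0; rewrite !castmx_id; split.
  - exact: hallA_core.
  - by rewrite -framed_hall_mx; apply: framed_equiv.
  - exact: framed_switched_mx.
(* The line [f x.1] carries its own sign, which is combined with that of [x]. *)
pose sg (f : 'I_N -> svert N) (x : svert N) : svert N :=
  ((f x.1).1, (f x.1).2 (+) x.2).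
have sgI f : injective (fun i => (f i).1) -> injective (sg f).
  move=> fI [i a] [j b] [/fI ij]; subst j; by move/addbI => ->.
have ssg f x : sg f x = if x.2 then ng (f x.1) else f x.1.
  by rewrite /sg /ng; case: (f x.1) => i b; case: x.2; rewrite /= ?addbT ?addbF.
have ssgE x y : ssent (sg fr x) (sg fc y) = sent H' x y.
  have sl x' y' : ssent (ng x') y' = - ssent x' y'.
    rewrite /ssent /switched sent_ngl zR; case: cR_cl => -> _ _.
    by rewrite mulrN.
  have sr x' y' : ssent x' (ng y') = - ssent x' y'.
    rewrite /ssent /switched sent_ngr zC; case: cC_cl => -> _ _.
    by rewrite mulrN.
  rewrite !ssg /sent mxE.
  by case: x.2; case: y.2; rewrite ?sl ?sr ?expr0 ?expr1; lia.
pose g (v : had_vertex N) : had_vertex N :=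
  match v with inl x => inl (sg fr x) | inr y => inr (sg fc y) end.
have gI : injective g.
  move=> [x|y] [x'|y'] //= [].
    by case: x x' => ? ? [? ?] E1 E2; congr inl;
      apply: (sgI _ fr_inj); rewrite /sg /= E1 E2.
  by case: y y' => ? ? [? ?] E1 E2; congr inr;
    apply: (sgI _ fc_inj); rewrite /sg /= E1 E2.
have gE v v' : e (g v) (g v') = had_graph H' v v'.
  case: v v' => [x|y] [x'|y'] /=.
  - rewrite e_rr (inj_eq (sgI _ fr_inj)); case: x x' => i a [j b].
    by rewrite xpair_eqE.
  - by rewrite e_rc ssgE -had_graph_row_col.
  - by rewrite e_cr ssgE -had_graph_col_row.
  - by rewrite e_cc; case: y y' => ? ? [? ?].
(* [g] leads from the graph of [H'] to [e]; [graph_iso] asks for the opposite direction. *)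
have [f gK fK] := injF_bij gI.
exists f; split; first by exists g.
by move=> v v'; rewrite -gE !fK.
Qed.

End Assembly.

(** * Cells of the graph *)

Definition sign_of (n : nat) (T : {set svert n}) (y : svert n) : int :=
  if y \in T then 1 else -1.

(** * Labels and patterns on one side of the graph *)

Section Side.

Variables (n m : nat) (H : 'M[int]_n) (D0 E0 A : {set svert n}).
Variable X : 'I_4 -> bool -> {set svert n}.
Hypothesis H_had : hadamard H.
Hypothesis m_gt0 : (0 < m)%N.
Hypotheses (D0_ng : forall x, (ng x \in D0) = (x \in D0)) (D0_card : #|D0| = 8).
Hypotheses (E0_ng : forall x, (ng x \in E0) = (x \in E0)) (E0_card : #|E0| = 8).
Hypotheses (A_ng : forall x, (ng x \in A) = (x \in A)) (A_card : #|A| = (2 * m)%N).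
Hypothesis X_card : forall k b, k != o40 -> #|X k b| = m.

(** Exactly four of the eight vertices of [E0] are neighbours of [x], so [T] contains them all. *)
Lemma adj_quad (T : {set svert n}) x : T \subset E0 -> #|T| = 4 ->
    (forall y, y \in T -> sent H x y = 1) ->
  forall y, y \in E0 -> sent H x y = sign_of T y.
Proof.
move=> sTE T4 xT y yE.
have : T == [set y in E0 | sent H x y == 1].
  rewrite eqEcard; apply/andP; split.
    by apply/subsetP => z zT; rewrite inE (subsetP sTE) //= xT.
  by have := card_adj_half x H_had E0_ng; rewrite T4 E0_card; lia.
rewrite /sign_of => /eqP ->; rewrite inE yE /=.
by case: (sent_pm1 x y H_had) => ->.
Qed.

(** A vertex and its negative cannot both be joined to [T], so at most one is in [S]. By counting,
    the rest of [A] consists of the negatives of [S] and has the opposite pattern. *)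
Lemma half_pattern (S T : {set svert n}) :
    S \subset A -> #|S| = m -> T \subset E0 -> #|T| = 4 ->
    (forall x y, x \in S -> y \in T -> sent H x y = 1) ->
  forall x y, x \in A -> y \in E0 ->
    sent H x y = (-1) ^+ (x \notin S) * sign_of T y.
Proof.
move=> sSA S_card sTE T4 ST x y xA yE.
have adjS z : z \in S -> sent H z y = sign_of T y.
  by move=> zS; apply: adj_quad => // w; apply: ST.
case: (boolP (x \in S)) => xS; first by rewrite adjS // expr0 mul1r.
suff : ng x \in S.
  by move/adjS; rewrite sent_ngl expr1 => <-; rewrite mulN1r opprK.
have [t tT] : exists t, t \in T by apply/card_gt0P; rewrite T4.
have : (@ng n) @: S == A :\: S.
  rewrite eqEcard cardsD (setIidPr sSA) card_imset; last exact: inv_inj (@ngK n).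
  rewrite A_card S_card; apply/andP; split; last by lia.
  apply/subsetP => _ /imsetP[z zS ->]; rewrite inE A_ng (subsetP sSA) // andbT.
  by apply/negP => zS'; have := ST _ _ zS' tT; rewrite sent_ngl ST.
move=> /eqP E; have : x \in A :\: S by rewrite inE xS.
by rewrite -E => /imsetP[z zS ->]; rewrite ngK.
Qed.

(** Two disjoint quadruples in the eight vertices of [E0] are complementary, which makes the
    patterns of [X0] and [X1] opposite. *)
Lemma quad_pattern (X0 X1 Q0 Q1 : {set svert n}) :
    Q0 \subset E0 -> Q1 \subset E0 -> #|Q0| = 4 -> #|Q1| = 4 ->
    [disjoint Q0 & Q1] ->
    (forall x y, x \in X0 -> y \in Q0 -> sent H x y = 1) ->
    (forall x y, x \in X1 -> y \in Q1 -> sent H x y = 1) ->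
  forall b x y, x \in (if b then X1 else X0) -> y \in E0 ->
    sent H x y = (-1) ^+ nat_of_bool b * sign_of Q0 y.
Proof.
move=> s0 s1 c0 c1 dQ a0 a1 [] x y xX yE; last first.
  by rewrite expr0 mul1r; apply: adj_quad => // z; apply: a0.
rewrite (adj_quad s1 c1) ?expr1 //; last by move=> z; apply: a1.
have : Q1 == E0 :\: Q0.
  rewrite eqEcard cardsD (setIidPr s0) E0_card c0 c1 andbT.
  apply/subsetP => z z1; rewrite inE (subsetP s1) // andbT.
  by apply/negP => z0; move/pred0P/(_ z): dQ; rewrite /= z0 z1.
rewrite /sign_of => /eqP ->; rewrite inE yE andbT.
by case: (y \in Q0).
Qed.

Hypothesis half : exists S T : {set svert n},
  [/\ S \subset A, #|S| = m, T \subset E0, #|T| = 4%N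
    & forall x y, x \in S -> y \in T -> sent H x y = 1].
Hypothesis quad : forall k, k != o40 -> exists Q : bool -> {set svert n},
  [/\ forall b, Q b \subset E0, forall b, #|Q b| = 4,
      [disjoint Q false & Q true]
    & forall b x y, x \in X k b -> y \in Q b -> sent H x y = 1].
Hypothesis covers : forall x, [\/ x \in D0, x \in A |
  exists2 k, k != o40 & exists b, x \in X k b].
Hypotheses (DA : [disjoint D0 & A])
  (DX : forall k b, k != o40 -> [disjoint D0 & X k b])
  (AX : forall k b, k != o40 -> [disjoint A & X k b])
  (XX : forall k b l b' x, k != o40 -> l != o40 ->
    x \in X k b -> x \in X l b' -> k = l /\ b = b').

(** [D0] and [E0] are the special vertices on this and on the opposite side, [A] is the large cell
    of this side and the [X k b] are its small ones. The large cell is cut into halves by [S], while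
    each other class has two small cells as its halves. *)
Lemma side_classes : exists (c : svert n -> option ('I_4 * bool))
    (U : 'I_4 -> svert n -> int),
  [/\ classified m c,
      [/\ forall x, (c x == None) = (x \in D0),
          forall x, in_zero_class (c x) = (x \in A)
        & forall k b x, k != o40 -> (c x == Some (k, b)) = (x \in X k b)],
      forall k y, pm1 (U k y)
    & forall k b x y, c x = Some (k, b) -> y \in E0 ->
        sent H x y = (-1) ^+ b * U k y].
Proof.
have [S [T [sSA S_card sTE T4 ST]]] := half.
pose c x := if x \in D0 then None else if x \in A then Some (o40, x \notin S)
  else [pick kb | (kb.1 != o40) && (x \in X kb.1 kb.2)].
have cX x k b : k != o40 -> (c x == Some (k, b)) = (x \in X k b).
  move=> k0; rewrite /c; apply/idP/idP.
    case: ifP => // _; case: ifP => _.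
      by move=> /eqP[k0' _]; rewrite -k0' eqxx in k0.
    by case: pickP => // -[l b'] /= /andP[_ xX] /eqP[<- <-].
  move=> xX; case: ifP => [xD|_].
    by move/pred0P/(_ x): (DX b k0); rewrite /= xD xX.
  case: ifP => [xA|_].
    by move/pred0P/(_ x): (AX b k0); rewrite /= xA xX.
  case: pickP => [[l b'] /= /andP[l0 xX']|/(_ (k, b))]; last by rewrite /= k0 xX.
  by have [-> ->] := XX l0 k0 xX' xX.
have cN x : (c x == None) = (x \in D0).
  rewrite /c; case: ifP => // xD; case: ifP => // xA.
  case: pickP => // noX; case: (covers x); rewrite ?xD ?xA // => -[k k0 [b xX]].
  by have := noX (k, b); rewrite /= k0 xX.
have c0 x : in_zero_class (c x) = (x \in A).
  rewrite /c; case: ifP => xD.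
    by apply/esym/negP => xA; move/pred0P/(_ x): DA; rewrite /= xD xA.
  case: ifP => // xA; case: pickP => // -[k b] /= /andP[k0 _].
  exact: negbTE.
have cS x b : (c x == Some (o40, b)) = (x \in A) && ((x \notin S) == b).
  rewrite /c; case: ifP => xD.
    by apply/esym/negP => /andP[xA _]; move/pred0P/(_ x): DA; rewrite /= xD xA.
  case: ifP => // xA; case: pickP => // -[k b'] /= /andP[k0 _].
  by apply/eqP => -[k0' _]; rewrite k0' eqxx in k0.
pose good k u := (forall y, pm1 (u y)) /\ forall b x y, c x = Some (k, b) ->
  y \in E0 -> sent H x y = (-1) ^+ nat_of_bool b * u y.
have sp (B : {set svert n}) y : pm1 (sign_of B y).
  by rewrite /sign_of; case: ifP; [left | right].
have [U UE] : exists U : 'I_4 -> svert n -> int, forall k, good k (U k).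
  apply: fin_all_exists => k; case: (eqVneq k o40) => [->|k0].
    exists (sign_of T); split=> // b x y /eqP; rewrite cS => /andP[xA /eqP <-] yE.
    exact: half_pattern.
  have [Q [QE Q4 Qd QX]] := quad k0; exists (sign_of (Q false)); split=> // b x y.
  move=> /eqP; rewrite cX // => xX yE.
  apply: (quad_pattern (X0 := X k false) (X1 := X k true) (QE _) (QE _)
    (Q4 _) (Q4 _) Qd) => //; try exact: QX.
  by case: b xX.
exists c, U; split=> //.
- split.
  + by move=> x; rewrite !cN D0_ng.
  + by rewrite -D0_card; apply: eq_card => x; rewrite inE cN.
  move=> k b; case: (eqVneq k o40) => [->|k0]; last first.
    by rewrite -(X_card b k0); apply: eq_card => x; rewrite inE cX.
  case: b.
    transitivity #|A :\: S|.
      by apply: eq_card => x; rewrite !inE cS eqb_id andbC.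
    by rewrite cardsD (setIidPr sSA) A_card S_card; lia.
  rewrite -S_card; apply: eq_card => x; rewrite inE cS eqbF_neg negbK.
  by rewrite andbC; case: (boolP (x \in S)) => // /(subsetP sSA).
- by split=> // k b x; apply: cX.
- by move=> k; apply: (UE k).1.
- by move=> k; apply: (UE k).2.
Qed.

End Side.

(* The side [s] is [true] for row vertices and [false] for column vertices. *)
Definition sv (n : nat) (s : bool) (x : svert n) : had_vertex n :=
  if s then inl x else inr x.

(** The rows of [sH s H] are the lines of side [s], so that one argument serves both sides. *)
Definition sH (n : nat) (s : bool) (H : 'M[int]_n) : 'M[int]_n :=
  if s then H else H^T.

Definition svset (n : nat) (s : bool) (B : {set had_vertex n}) : {set svert n} :=
  [set x | sv s x \in B].

Section SignedVertices.

Variables (n : nat) (H : 'M[int]_n).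
Hypothesis H_had : hadamard H.

Lemma sv_inj s : injective (@sv n s).
Proof. by case: s => x y []. Qed.

Lemma svP (v : had_vertex n) : exists s x, v = sv s x.
Proof. by case: v => x; [exists true, x | exists false, x]. Qed.

Lemma adj_other s x y : had_graph H (sv s x) (sv (~~ s) y) = (sent (sH s H) x y == 1).
Proof.
by case: s; rewrite ?had_graph_row_col ?had_graph_col_row //= sent_tr.
Qed.

Lemma adj_same s x y : had_graph H (sv s x) (sv s y) = s && (x == y).
Proof. by case: s x y => [] [i a] [j b]. Qed.

Lemma had_graph_sym v w : had_graph H v w = had_graph H w v.
Proof.
by case: v w => [[i a]|[i a]] [[j b]|[j b]] //=; rewrite eq_sym [a == b]eq_sym.
Qed.

Lemma loop_sv s x : had_graph H (sv s x) (sv s x) = s.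
Proof. by rewrite adj_same eqxx andbT. Qed.

Lemma sH_had s : (0 < n)%N -> hadamard (sH s H).
Proof. by case: s => // n0; apply: hadamard_tr. Qed.

Lemma card_svset s (B : {set had_vertex n}) :
  #|svset s B| = #|[set v in B | had_graph H v v == s]|.
Proof.
rewrite -(card_imset _ (@sv_inj s)); apply: eq_card => v; rewrite inE.
apply/imsetP/andP => [[x + ->]|[]].
  by rewrite inE loop_sv eqxx.
by have [t [x ->]] := svP v; rewrite loop_sv => xB /eqP <-; exists x; rewrite ?inE.
Qed.

End SignedVertices.

(** Otherwise [y] excludes the signs 1, 1 and [ng y] excludes -1, -1, so all products are -1 and
    their sum cannot vanish. *)
Lemma common_nbr (n : nat) (H : 'M[int]_n) (x x' : svert n) :
  hadamard H -> x.1 != x'.1 -> exists y, sent H x y = 1 /\ sent H x' y = 1.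
Proof.
move=> hH xx'.
case: (pickP (fun y => (sent H x y == 1) && (sent H x' y == 1))) => [y|no].
  by move=> /andP[/eqP ? /eqP ?]; exists y.
have := sent_row_orth hH xx'; rewrite (eq_bigr (fun=> -1)) => [|y _].
  rewrite sumr_const mulNrn => /eqP; rewrite oppr_eq0 pnatr_eq0.
  by move=> /eqP /card0_eq /(_ x).
have := no y; have := no (ng y); rewrite !sent_ngr.
by case: (sent_pm1 x y hH) => ->; case: (sent_pm1 x' y hH) => ->.
Qed.

(** * Cells of the partition and the effect of GM-switching *)

Section HadamardGraph.

Variables (n : nat) (H : 'M[int]_n).
Hypothesis H_had : hadamard H.
Let e := had_graph H.

(** Vertices of one side on different lines have a common neighbour, so the partner of a vertex in a
    paired set is its negative. *)
Lemma paired_ng s (B : {set had_vertex n}) x :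
  paired e B -> (ng x \in svset s B) = (x \in svset s B).
Proof.
move=> pB; suff key z : z \in svset s B -> ng z \in svset s B.
  by apply/idP/idP; [rewrite -{2}(ngK x)|]; apply: key.
rewrite !inE => zB; have [v [vB vz]] := pB _ zB.
have [t [w wE]] := svP v; rewrite {v}wE in vB vz *.
rewrite /e !loop_sv => ts; subst t; move=> noc.
have n0 : (0 < n)%N by apply: leq_ltn_trans (ltn_ord z.1).
have zw : z.1 = w.1.
  apply/eqP/negPn/negP => /(common_nbr (sH_had H_had s n0))[y [zy wy]].
  by have := noc (sv (~~ s) y); rewrite /e !adj_other zy wy eqxx.
case: (svert_eq1 zw) => zwE; first by rewrite zwE eqxx in vz.
by rewrite zwE ngK.
Qed.

Variables (D : {set had_vertex n}) (C : 'I_14 -> {set had_vertex n}).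

(* The halves of the classes 1, 2, 3 are C_3, C_4, C_7, C_8, C_11, C_12 for rows
   and C_5, C_6, C_9, C_10, C_13, C_14 for columns; class 0 is a single cell. *)
Definition cell_idx (s : bool) (k : 'I_4) (b : bool) : nat :=
  if k == o40 then (if s then 1 else 2)
  else if s then (4 * k + b).-1 else (4 * k + b).+1.

Lemma cell_idx_le s k b : (0 < cell_idx s k b <= 14)%N.
Proof. by move: k; apply: ord4_ind; case: s; case: b. Qed.

Lemma cell_idx_ge3 s k b : k != o40 -> (3 <= cell_idx s k b <= 14)%N.
Proof. by move: k; apply: ord4_ind; case: s; case: b. Qed.

Lemma cell_idx_inj s k b l b' : k != o40 -> l != o40 ->
  cell_idx s k b = cell_idx s l b' -> k = l /\ b = b'.
Proof.
by move: k l; apply: ord4_ind => //; apply: ord4_ind => //;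
  case: s; case: b; case: b'.
Qed.

Lemma cell_idx0 s k b : k != o40 -> cell_idx s k b != cell_idx s o40 false.
Proof. by move: k; apply: ord4_ind => //; case: s; case: b. Qed.

Lemma cell_idx_exhaust (i : 'I_14) : exists s k b, C i = cell C (cell_idx s k b).
Proof.
suff [s [k [b E]]] : exists s k b, (cell_idx s k b).-1 = i.
  by exists s, k, b; rewrite /cell E inord_val.
case: i => -[|[|[|[|[|[|[|[|[|[|[|[|[|[|//]]]]]]]]]]]]]] /= _.
- by exists true, o40, false.
- by exists false, o40, false.
- by exists true, o41, false.
- by exists true, o41, true.
- by exists false, o41, false.
- by exists false, o41, true.
- by exists true, o42, false.
- by exists true, o42, true.
- by exists false, o42, false.
- by exists false, o42, true.
- by exists true, o43, false.
- by exists true, o43, true.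
- by exists false, o43, false.
- by exists false, o43, true.
Qed.

Variable m : nat.
Hypothesis m_gt0 : (0 < m)%N.
Hypothesis part : switching_partition e C D.
Hypothesis D_card : forall s, #|svset s D| = 8.
Hypothesis cellA_card : forall s, #|cell C (cell_idx s o40 false)| = (2 * m)%N.
Hypothesis cellX_card : forall s k b, k != o40 -> #|cell C (cell_idx s k b)| = m.
Hypothesis cell_loop : forall s k b v, v \in cell C (cell_idx s k b) -> e v v = s.
Hypothesis D_paired : paired e D.
Hypothesis A_paired : forall s, paired e (cell C (cell_idx s o40 false)).
Hypothesis A_half : forall s, half_joined e (cell C (cell_idx s o40 false)) D.
Hypothesis quads : forall k, k \in [:: 3; 7; 11]%N -> quadruples_joined e C D k.

Lemma cells_cover v : v \in D \/ exists i, v \in C i.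
Proof.
case: part => -[/cover_partition cov _ _] _ _.
have : v \in cover (D |: [set C i | i : 'I_14]) by rewrite cov inE.
case/bigcupP => B; rewrite in_setU1 => /orP[/eqP -> ?|]; first by left.
by case/imsetP => i _ -> ?; right; exists i.
Qed.

Lemma cells_disjoint i j v : v \in C i -> v \in C j -> i = j.
Proof.
case: part => -[/and3P[_ /trivIsetP tI _] Cinj _] _ _ vi vj.
apply/eqP/negPn/negP => ij; have CC : C i != C j by apply: contra_neq ij => /Cinj.
have inP l : C l \in D |: [set C i | i : 'I_14].
  by rewrite in_setU1 imset_f ?orbT.
by have /pred0P/(_ v) := tI _ _ (inP i) (inP j) CC; rewrite /= vi vj.
Qed.

Lemma D_cell_disjoint i v : v \in C i -> v \notin D.
Proof.
case: part => -[/and3P[_ /trivIsetP tI _] _ CD] _ _ vi; apply/negP => vD.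
have inP l : C l \in D |: [set C i | i : 'I_14].
  by rewrite in_setU1 imset_f ?orbT.
have DP : D \in D |: [set C i | i : 'I_14] by rewrite in_setU1 eqxx.
by have /pred0P/(_ v) := tI _ _ (inP i) DP (CD i); rewrite /= vi vD.
Qed.

Lemma cell_side s t k b x : sv s x \in cell C (cell_idx t k b) -> t = s.
Proof. by move=> /cell_loop; rewrite /e loop_sv. Qed.

Lemma cellX_disjoint s k b l b' v : k != o40 -> l != o40 ->
  v \in cell C (cell_idx s k b) -> v \in cell C (cell_idx s l b') ->
  k = l /\ b = b'.
Proof.
move=> k0 l0 vk vl; apply: (cell_idx_inj (s := s)) => //.
have := cells_disjoint vk vl; move=> /(congr1 val) /=.
have := cell_idx_le s k b; have := cell_idx_le s l b'.
by move=> /andP[? ?] /andP[? ?]; rewrite !inordK; lia.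
Qed.

Lemma cellAX_disjoint s k b v : k != o40 ->
  v \in cell C (cell_idx s o40 false) -> v \notin cell C (cell_idx s k b).
Proof.
move=> k0 vA; apply/negP => vX; have := cell_idx0 s b k0.
have := cells_disjoint vA vX; move=> /(congr1 val) /=.
have := cell_idx_le s k b; have := cell_idx_le s o40 false.
by move=> /andP[? ?] /andP[? ?]; rewrite !inordK; lia.
Qed.

Local Notation X s k b := (svset s (cell C (cell_idx s k b))).
Local Notation A s := (X s o40 false).

Lemma card_cell s k b :
  #|svset s (cell C (cell_idx s k b))| = #|cell C (cell_idx s k b)|.
Proof.
rewrite (card_svset H); apply: eq_card => v; rewrite inE andbC.
by case: (boolP (v \in _)) => [/cell_loop E|]; rewrite ?andbF // -[had_graph H]/e E eqxx.
Qed.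

(* On its own side a vertex is adjacent at most to itself. *)
Lemma joined_other_side s (T : {set had_vertex n}) x :
    T \subset D -> sv s x \notin D ->
    (forall y, y \in T -> e (sv s x) y) ->
  [/\ svset (~~ s) T \subset svset (~~ s) D, #|svset (~~ s) T| = #|T|
    & forall y, y \in svset (~~ s) T -> sent (sH s H) x y = 1].
Proof.
move=> sTD xD xT.
have Tside t y : sv t y \in T -> t = ~~ s.
  move=> yT; have := xT _ yT; have yD := subsetP sTD _ yT.
  case: (eqVneq t s) => [ts|]; last by case: t s {xD xT yT yD} => [] [].
  by subst t; rewrite /e adj_same => /andP[_ /eqP xy]; rewrite xy yD in xD.
split.
- by apply/subsetP => y; rewrite !inE => /(subsetP sTD).
- rewrite (card_svset H); apply: eq_card => v; rewrite inE andbC.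
  have [t [y ->]] := svP v; rewrite loop_sv.
  by case: (boolP (sv t y \in T)) => [/Tside ->|]; rewrite ?eqxx ?andbF.
- by move=> y; rewrite inE => /xT; rewrite /e adj_other => /eqP.
Qed.

Lemma n_gt0 : (0 < n)%N.
Proof.
have : (0 < #|svset true D|)%N by rewrite D_card.
by case/card_gt0P => x _; apply: leq_ltn_trans (ltn_ord x.1).
Qed.

Lemma graph_classes s : exists (c : svert n -> option ('I_4 * bool))
    (U : 'I_4 -> svert n -> int),
  [/\ classified m c,
      [/\ forall x, (c x == None) = (x \in svset s D),
          forall x, in_zero_class (c x) = (x \in A s)
        & forall k b x, k != o40 -> (c x == Some (k, b)) = (x \in X s k b)],
      forall k y, pm1 (U k y)
    & forall k b x y, c x = Some (k, b) -> y \in svset (~~ s) D ->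
        sent (sH s H) x y = (-1) ^+ b * U k y].
Proof.
have XD k b x : x \in X s k b -> sv s x \notin D.
  by rewrite inE; apply: D_cell_disjoint.
apply: side_classes => //.
- exact: sH_had n_gt0.
- by move=> x; apply: paired_ng.
- by move=> x; apply: paired_ng.
- by move=> x; apply: paired_ng => //; apply: A_paired.
- by rewrite card_cell.
- by move=> k b k0; rewrite card_cell cellX_card.
- have [S [T [sSA S_card sTD T4 ST]]] := A_half s.
  have Sc : #|svset s S| = #|S|.
    rewrite (card_svset H); apply: eq_card => v; rewrite inE andbC.
    case: (boolP (v \in S)) => [/(subsetP sSA)/cell_loop E|]; rewrite ?andbF //.
    by rewrite -[had_graph H]/e E eqxx.
  have Sm : #|svset s S| = m by move: S_card; rewrite cellA_card Sc; lia.
  have joined x : x \in svset s S -> [/\ svset (~~ s) T \subset svset (~~ s) D,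
      #|svset (~~ s) T| = #|T|
    & forall y, y \in svset (~~ s) T -> sent (sH s H) x y = 1].
    move=> xS; apply: joined_other_side => //.
      by apply: (XD o40 false); move: xS; rewrite !inE => /(subsetP sSA).
    by move=> y; apply: ST; move: xS; rewrite inE.
  have [x0 x0S] : exists x, x \in svset s S by apply/card_gt0P; rewrite Sm.
  have [TD Tc _] := joined _ x0S.
  exists (svset s S), (svset (~~ s) T); split=> //.
  + by apply/subsetP => x; rewrite !inE => /(subsetP sSA).
  + by rewrite Tc.
  + by move=> x y /joined[_ _]; apply.
- move=> k k0; have kq : (4 * k).-1 \in [:: 3; 7; 11]%N.
    by move: k k0; apply: ord4_ind.
  have [Q [Q4 Qd QD Qe]] := quads kq.
  (* Of the four consecutive cells joined to the quadruples, the first two consist of rows and the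
     last two of columns. *)
  pose q b := if s then (if b then o41 else o40) else (if b then o43 else o42).
  have qE b : cell C (cell_idx s k b) = cell C ((4 * k).-1 + q b).
    congr cell; rewrite /cell_idx (negPf k0) /q; move: (k) k0.
    by apply: ord4_ind => //; case: (s); case: b.
  have joined b x : x \in X s k b -> [/\ svset (~~ s) (Q (q b)) \subset svset (~~ s) D,
      #|svset (~~ s) (Q (q b))| = #|Q (q b)|
    & forall y, y \in svset (~~ s) (Q (q b)) -> sent (sH s H) x y = 1].
    move=> xX; apply: joined_other_side.
    + by apply/subsetP => y yQ; rewrite -QD; apply/bigcupP; exists (q b).
    + exact: XD xX.
    + move=> y yQ; rewrite /e had_graph_sym; apply: Qe yQ.
      by rewrite -qE; move: xX; rewrite inE.
  have X_ne b : exists x, x \in X s k b.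
    by apply/card_gt0P; rewrite card_cell cellX_card.
  exists (fun b => svset (~~ s) (Q (q b))); split.
  + by move=> b; have [x /joined[]] := X_ne b.
  + by move=> b; have [x /joined[_ -> _]] := X_ne b.
  + have /pred0P dQ : [disjoint Q (q false) & Q (q true)].
      by apply: Qd; rewrite /q; case: (s).
    by apply/pred0P => y; have := dQ (sv (~~ s) y); rewrite /= !inE.
  + by move=> b x y /joined[_ _]; apply.
- move=> x; case: (cells_cover (sv s x)) => [xD|[i]].
    by apply: Or31; rewrite inE.
  have [t [k [b ->]]] := cell_idx_exhaust i => xC.
  have ts := cell_side xC; subst t.
  case: (eqVneq k o40) => k0.
    by apply: Or32; move: xC; rewrite k0 inE /cell_idx.
  by apply: Or33; exists k => //; exists b; rewrite inE.
- apply/pred0P => x /=; rewrite !inE; apply/negbTE/negP => /andP[xD].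
  by move/D_cell_disjoint/negP.
- move=> k b k0; apply/pred0P => x /=; rewrite !inE.
  by apply/negbTE/negP => /andP[xD /D_cell_disjoint/negP].
- move=> k b k0; apply/pred0P => x /=; rewrite !inE.
  by apply/negbTE/negP => /andP[/(cellAX_disjoint b k0)/negP].
- by move=> k b l b' x k0 l0; rewrite !inE; apply: cellX_disjoint.
Qed.

Lemma nbrs_in_other s k b x :
  nbrs_in e (sv s x) (cell C (cell_idx (~~ s) k b)) =
  #|[set y in X (~~ s) k b | sent (sH s H) x y == 1]|.
Proof.
rewrite /nbrs_in -(card_imset _ (@sv_inj n (~~ s))); apply: eq_card => v.
rewrite inE; apply/andP/imsetP => [[vC xv]|[y]].
  have [t [y vE]] := svP v; subst v; have ts := cell_side vC; subst t.
  by exists y => //; rewrite !inE vC -adj_other.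
by rewrite !inE => /andP[yC xy] ->; rewrite yC /e adj_other.
Qed.

(* The equitable partition gives x and ng x, which lie in the same cell, equally
   many neighbours in each cell. *)
Lemma A_balanced s k b x : x \in A s ->
  \sum_(y in X (~~ s) k b) sent (sH s H) x y = 0.
Proof.
move=> xA; have nxA : ng x \in A s by rewrite paired_ng.
have sHh := sH_had H_had s n_gt0.
have [_ eq_nbrs _] := part.
have := eq_nbrs _ (inord (cell_idx (~~ s) k b).-1) (sv s x) (sv s (ng x)).
move: xA nxA; rewrite !inE => xA nxA /(_ _ xA nxA).
rewrite -/(cell C _) !nbrs_in_other => En.
have := pm1_sum_card (A := X (~~ s) k b) (fun y _ => sent_pm1 x y sHh).
have := pm1_sum_card (A := X (~~ s) k b) (fun y _ => sent_pm1 (ng x) y sHh).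
rewrite -En => <-; under [Z in _ = Z -> _]eq_bigr do rewrite sent_ngl.
by rewrite sumrN; move: (\sum_(y in _) _) => z; clear; lia.
Qed.

(** On its own side a special vertex has no neighbour outside [D], and 0 is not half the size of a
    nonempty cell. *)
Lemma gm_flip_same s x y : gm_flip e C D (sv s x) (sv s y) = false.
Proof.
rewrite /gm_flip; case: (boolP (_ \in D)) => //= xD; apply/existsP => -[i].
have [t [k [b ->]]] := cell_idx_exhaust i => /andP[yC].
have ts := cell_side yC; subst t.
suff -> : nbrs_in e (sv s x) (cell C (cell_idx s k b)) = 0%N.
  by rewrite muln0 eq_sym => /eqP /cards0_eq E; rewrite E inE in yC.
apply: eq_card0 => v; rewrite inE; apply/negP => /andP[vC].
have [t [z vE]] := svP v; subst v; have ts := cell_side vC; subst t.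
rewrite /e adj_same => /andP[_ /eqP xz]; subst z.
by have := D_cell_disjoint vC; rewrite xD.
Qed.

(** A small cell has constant sign against a special vertex [x], which sees all or none of it, never
    half. The large cell is closed under [ng], so [x] sees exactly half. *)
Lemma gm_flip_other s x y :
  gm_flip e C D (sv s x) (sv (~~ s) y) = (x \in svset s D) && (y \in A (~~ s)).
Proof.
have sHh := sH_had H_had s n_gt0.
rewrite /gm_flip inE; case: (boolP (_ \in D)) => //= xD.
apply/existsP/idP => [[i]|yA].
  have [t [k [b ->]]] := cell_idx_exhaust i => /andP[yC].
  have ts := cell_side yC; subst t.
  case: (eqVneq k o40) => k0; first by move: yC; rewrite k0 inE /cell_idx.
  (* Labels are taken on the side of [y], where patterns record the signs against special vertices
     such as [x]. *)
  have [c [U [_ [_ _ cX] _ pU]]] := graph_classes (~~ s).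
  have yX : y \in X (~~ s) k b by rewrite inE.
  have adj z : z \in X (~~ s) k b -> sent (sH s H) x z = sent (sH s H) x y.
    have tr w : sent (sH s H) x w = sent (sH (~~ s) H) w x.
      by rewrite -sent_tr; case: (s); rewrite //= trmxK.
    have xD' : x \in svset (~~ ~~ s) D by rewrite negbK inE.
    rewrite -!cX // in yX * => /eqP zX.
    by rewrite !tr (pU _ _ _ _ zX xD') (pU _ _ _ _ (eqP yX) xD').
  rewrite nbrs_in_other => /eqP E.
  have Xpos : (0 < #|X (~~ s) k b|)%N by apply/card_gt0P; exists y.
  have cc := card_cell (~~ s) k b.
  case: (eqVneq (sent (sH s H) x y) 1) => sxy.
    suff XE : #|[set y0 in X (~~ s) k b | sent (sH s H) x y0 == 1]| =
        #|X (~~ s) k b| by rewrite XE -cc in E; lia.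
    apply: eq_card => z; rewrite inE.
    by case: (boolP (z \in _)) => //= /adj ->; rewrite sxy eqxx.
  suff XE : #|[set y0 in X (~~ s) k b | sent (sH s H) x y0 == 1]| = 0%N.
    by rewrite XE -cc in E; lia.
  apply: eq_card0 => z; rewrite inE.
  by case: (boolP (z \in _)) => //= /adj ->; rewrite (negPf sxy).
exists (inord (cell_idx (~~ s) o40 false).-1); rewrite -/(cell C _).
move: (yA); rewrite inE => ->; rewrite nbrs_in_other -card_cell.
by rewrite (card_adj_half x sHh) ?eqxx // => z; apply: paired_ng.
Qed.

Lemma gm_switch_same s x y :
  gm_switch e C D (sv s x) (sv s y) = s && (x == y).
Proof. by rewrite /gm_switch !gm_flip_same addbF /e adj_same. Qed.

Lemma gm_switch_other s x y :
  gm_switch e C D (sv s x) (sv (~~ s) y) =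
  (sent (sH s H) x y == 1) (+) ((x \in svset s D) && (y \in A (~~ s)) ||
    (y \in svset (~~ s) D) && (x \in A s)).
Proof.
rewrite /gm_switch {1}/e adj_other gm_flip_other; congr (_ (+) (_ || _)).
by have := gm_flip_other (~~ s) y x; rewrite negbK.
Qed.

End HadamardGraph.

(** * From the switching partition to the Hall set *)

Lemma graph_hall_switch (m : nat) (N := (4 + \sum_(i < 4) m)%N)
    (H : 'M[int]_N) (D : {set had_vertex N}) (C : 'I_14 -> {set had_vertex N}) :
    hadamard H -> (0 < m)%N -> ~~ odd m ->
    switching_partition (had_graph H) C D ->
    (forall s, #|svset s D| = 8) ->
    (forall s, #|cell C (cell_idx s o40 false)| = (2 * m)%N) ->
    (forall s k b, k != o40 -> #|cell C (cell_idx s k b)| = m) ->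
    (forall s k b v, v \in cell C (cell_idx s k b) -> had_graph H v v = s) ->
    paired (had_graph H) D ->
    (forall s, paired (had_graph H) (cell C (cell_idx s o40 false))) ->
    (forall s, half_joined (had_graph H) (cell C (cell_idx s o40 false)) D) ->
    (forall k, k \in [:: 3; 7; 11]%N -> quadruples_joined (had_graph H) C D k) ->
  exists H' : 'M[int]_N,
    hall_switch H H' /\ graph_iso (gm_switch (had_graph H) C D) (had_graph H').
Proof.
move=> H_had m_gt0 m_even part D8 A_card X_card loop Dp Ap Ah quads.
have classes s := graph_classes H_had m_gt0 part D8 A_card X_card loop Dp Ap Ah
  quads s.
have [cR [U [cR_cl [cRN cR0 cRX] U_pm1 patU]]] := classes true.
have [cC [V [cC_cl [cCN cC0 cCX] V_pm1 patV]]] := classes false.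
have patU' k b x y : cR x = Some (k, b) -> cC y = None ->
    sent H x y = (-1) ^+ b * U k y.
  by move=> cx /eqP cy; apply: (patU _ _ _ _ cx); rewrite -cCN.
have patV' l b x y : cC y = Some (l, b) -> cR x = None ->
    sent H x y = (-1) ^+ b * V l x.
  move=> cy /eqP cx; rewrite -sent_tr.
  by apply: (patV _ _ _ _ cy); rewrite -cRN.
have bal x b0 l b : cR x = Some (o40, b0) -> l != o40 ->
    \sum_(y | cC y == Some (l, b)) sent H x y = 0.
  move=> cx l0; have xA : in_zero_class (cR x) by rewrite cx /= eqxx.
  rewrite cR0 in xA.
  have := A_balanced H_had part D8 loop Ap l b xA => E.
  by rewrite -[RHS]E; apply: eq_bigl => y; rewrite cCX.
have [dr [dc [cr [cc [kr [kc [[? ? ? ?] [? ? ? ?] [? ?] [? ? ?]]]]]]]] :=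
  normal_form H_had m_gt0 m_even cR_cl cC_cl U_pm1 V_pm1 patU' patV' bal.
have e_same s := gm_switch_same part loop s.
have e_other s := gm_switch_other H_had m_gt0 part D8 A_card X_card loop Dp Ap
  Ah quads s.
(* Complementing an adjacency amounts to negating the signed entry. *)
have flip x y : ((sent H x y == 1) (+) switched cR cC x y) =
    (ssent H cR cC x y == 1).
  rewrite /ssent; case: (switched cR cC x y); rewrite ?expr0 ?expr1;
    by case: (sent_pm1 x y H_had) => ->.
apply: (@hall_switch_exists m H cR cC dr dc cr cc kr kc) => //.
- by move=> x; rewrite !cR0; apply: (paired_ng H_had _ _ (Ap true)).
- by move=> x; rewrite !cC0; apply: (paired_ng H_had _ _ (Ap false)).
- by move=> x y; have := e_same true x y.
- by move=> x y; have := e_same false x y.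
- move=> x y; have := e_other true x y; rewrite /sv /= => ->.
  by rewrite -flip /switched cRN cCN cR0 cC0.
- move=> x y; have := e_other false y x; rewrite /sv /= => ->.
  by rewrite -flip /switched cRN cCN cR0 cC0 sent_tr orbC.
Qed.

Local Close Scope ring_scope.

Theorem theorem3p5 (n : nat) (H : 'M[int]_n)
    (n_mod8 : n = 4 %[mod 8])
    (H_had : hadamard H)
    (D : {set had_vertex n}) (C : 'I_14 -> {set had_vertex n})
    (part : switching_partition (had_graph H) C D)
    (cardD : #|D| = 16)
    (cardC12 : forall k, k \in [:: 1; 2] -> #|cell C k| = n %/ 2 - 2)
    (cardC : forall k, 3 <= k <= 14 -> #|cell C k| = n %/ 4 - 1)
    (D_loops : #|[set x in D | had_graph H x x]| = 8)
    (D_noloops : #|[set x in D | ~~ had_graph H x x]| = 8)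
    (D_paired : paired (had_graph H) D)
    (C1_loops : forall x, x \in cell C 1 -> had_graph H x x)
    (C1_paired : paired (had_graph H) (cell C 1))
    (C1_half : half_joined (had_graph H) (cell C 1) D)
    (C2_noloops : forall x, x \in cell C 2 -> ~~ had_graph H x x)
    (C2_paired : paired (had_graph H) (cell C 2))
    (C2_half : half_joined (had_graph H) (cell C 2) D)
    (C_loops : forall k, k \in [:: 3; 4; 7; 8; 11; 12] ->
       forall x, x \in cell C k -> had_graph H x x)
    (C_noloops : forall k, k \in [:: 5; 6; 9; 10; 13; 14] ->
       forall x, x \in cell C k -> ~~ had_graph H x x)
    (quads : forall k, k \in [:: 3; 7; 11] ->
       quadruples_joined (had_graph H) C D k) :
  exists H' : 'M[int]_n,
    hall_switch H H' /\
    graph_iso (gm_switch (had_graph H) C D) (had_graph H').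
Proof.
(* Members of a partition are nonempty, in particular [cell C 3]. *)
have m_gt0 : 0 < n %/ 4 - 1.
  rewrite -(cardC 3) //; case: (part) => -[/and3P[_ _ no0] _ _] _ _.
  rewrite card_gt0; apply: contra no0 => /eqP <-.
  by rewrite in_setU1 imset_f ?orbT.
have cellA s : #|cell C (cell_idx s o40 false)| = 2 * (n %/ 4 - 1).
  by case: s; rewrite /= cardC12 //; lia.
have cellX s k b : k != o40 -> #|cell C (cell_idx s k b)| = n %/ 4 - 1.
  by move=> k0; apply/cardC/cell_idx_ge3.
have D8 s : #|svset s D| = 8.
  rewrite (card_svset H); case: s; [rewrite -D_loops | rewrite -D_noloops];
    by apply: eq_card => v; rewrite !inE; case: had_graph.
have loop s k b v : v \in cell C (cell_idx s k b) -> had_graph H v v = s.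
  move: k; apply: ord4_ind; case: s; case: b => vC;
    by [apply: C1_loops | apply/negbTE/C2_noloops
       | apply: (C_loops _ _ _ vC) | apply/negbTE/(C_noloops _ _ _ vC)].
have nE : n = 4 + \sum_(i < 4) (n %/ 4 - 1).
  by rewrite sum_nat_const card_ord; lia.
(* [n %/ 4] is odd because [n] is 4 modulo 8. *)
have m_even : ~~ odd (n %/ 4 - 1) by lia.
have Ap s : paired (had_graph H) (cell C (cell_idx s o40 false)) by case: s.
have Ah s : half_joined (had_graph H) (cell C (cell_idx s o40 false)) D.
  by case: s.
(* With the quotient replaced by a variable [m], the order [n] can be substituted by the block size,
   and no casts between matrix types remain. *)
move: (n %/ 4 - 1) nE m_gt0 cellA cellX m_even => m nE m_gt0 cellA cellX m_even.
subst n; exact: graph_hall_switch.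
Qed.
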